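(* Let $A\in\mathcal M_n(\mathbb R)$, $B\in\mathcal M_{n,m}(\mathbb R)$, $C\in\mathcal M_n(\mathbb R)$, $z\in\mathbb R^n$, let $U\subseteq\mathbb R^m$ be nonempty, closed and convex, let $g:\mathbb R^n\to\mathbb R$ be locally Lipschitz and bounded from below, and let $x\in\mathbb R^n$. Assume that $(A,B)$ is $U$-stabilizable, that $(A,C)$ is detectable and that $A$ is invertible. Let $(\overline u,\overline y)$ be the unique pair in $M_s$ minimizing the steady functional $J_s$. For any $T>0$, let $u_T\in\mathcal U_T$ be an optimal control minimizing $J_{T,x}$ over $\mathcal U_T$, and let $y_T$ be its associated state trajectory, i.e. the solution to $\dot y_T=Ay_T+Bu_T$ in $(0,T)$, $y_T(0)=x$. Then, for any $\varepsilon\in(0,1)$, there exists $\tau=\tau(A,B,C,U,x,z,g,\varepsilon)>0$ such that, if $T\ge 2\tau+1$, then $$\|y_T(t)-\overline y\|<\varepsilon\qquad\text{for all } t\in[\tau,T-\tau].$$ Furthermore, there exists a constant $K=K(A,B,C,U,x,z,g)$ (in particular independent of $T$) such that $$\int_0^T\left[\|u_T(s)-\overline u\|^2+\|y_T(s)-\overline y\|^2\right]ds\le K .$$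
   Context: $\mathcal M_{n,m}(\mathbb R)$ denotes real $n\times m$ matrices and $\mathcal M_n(\mathbb R)$ real $n\times n$ matrices; $n,m\ge1$. Control problem: for $T>0$, $\mathcal U_T:=L^2(0,T;U)$ (square-integrable functions with values in $U$). For $u\in\mathcal U_T$ and $x\in\mathbb R^n$, $y$ denotes the solution to $\dot y(s)=Ay(s)+Bu(s)$, $s\in(0,T)$, $y(0)=x$, and $$J_{T,x}(u):=\frac12\int_0^T\left[\|u(s)\|^2+\|Cy(s)-z\|^2\right]ds+g(y(T)).$$ Steady problem: $J_s(u,y):=\frac12\left(\|u\|^2+\|Cy-z\|^2\right)$, to be minimized over $M_s:=\{(u,y)\in U\times\mathbb R^n : Ay+Bu=0\}$. (Existence and uniqueness of the minimizer follow from detectability of $(A,C)$.) $U$-stabilizability: let $y_1$ be a solution to $\frac{d}{ds}y_1(s)=Ay_1(s)+Bu_1(s)$, $s\in(0,+\infty)$, with some control $u_1\in L^2_{loc}(0,+\infty;U)$. $(A,B)$ is $U$-stabilizable to $y_1$ from the initial datum $x\in\mathbb R^n$ if there exists a control $u\in L^2_{loc}(0,+\infty;U)$ such that the solution $y$ to $\frac{d}{ds}y=Ay+Bu$ in $(0,+\infty)$, $y(0)=x$, satisfies: (1) $u-u_1\in L^1(0,+\infty;\mathbb R^m)\cap L^2(0,+\infty;\mathbb R^m)$; (2) $y-y_1\in L^1(0,+\infty;\mathbb R^n)\cap L^2(0,+\infty;\mathbb R^n)$; (3) $\|u-u_1\|_{L^1\cap L^2}+\|y-y_1\|_{L^1\cap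 L^2}\le K\|y_1(0)-x\|$, where $\|\cdot\|_{L^1\cap L^2}:=\|\cdot\|_{L^1(0,+\infty)}+\|\cdot\|_{L^2(0,+\infty)}$ and $K=K(A,B,U)$ is a constant depending only on $A,B,U$. $(A,B)$ is called $U$-stabilizable when this holds for every such trajectory $y_1$ (with any control $u_1\in L^2_{loc}(0,+\infty;U)$) and every initial datum $x\in\mathbb R^n$. $(A,C)$ detectable: there exists a matrix $L$ such that all eigenvalues of $A+LC$ have negative real part (equivalently, all modes of $A$ associated with eigenvalues of nonnegative real part are observable through $C$). *)

(* Defs.v *)
From HB Require Import structures.
From mathcomp Require Import all_boot all_order all_algebra.
From mathcomp Require Import all_classical all_reals all_analysis.
From mathcomp Require Import complex.

Set Implicit Arguments.
Unset Strict Implicit.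
Unset Printing Implicit Defensive.

Import Order.TTheory GRing.Theory Num.Theory.
Import numFieldNormedType.Exports.

Local Open Scope classical_set_scope.
Local Open Scope ring_scope.

(* The Euclidean norm: the library norm [`|v|] on matrices is the sup norm,
   which is equivalent but enters quantitative statements differently. *)
Definition enorm (R : realType) (k : nat) (v : 'cV[R]_k) : R :=
  Num.sqrt (\sum_(i < k) v i 0 ^+ 2).

Definition Lnorm_on (R : realType) (k : nat) (p : \bar R) (D : set R)
    (f : R -> 'cV[R]_k) : \bar R :=
  'N[lebesgue_measure]_p[(fun t => (enorm (f t))%:E) \_ D]%E.

Definition in_Lp (R : realType) (k : nat) (p : \bar R) (D : set R)
    (f : R -> 'cV[R]_k) : Prop :=
  (forall i, measurable_fun D (fun t => f t i 0)) /\ (Lnorm_on p D f < +oo)%E.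

(* L^2(0,T;U): elements are defined up to null sets, so the constraint is
   imposed almost everywhere. *)
Definition admissible_control (R : realType) (m : nat) (U : set 'cV[R]_m)
    (T : R) (u : R -> 'cV[R]_m) : Prop :=
  in_Lp 2%:E `]0, T[ u /\
  {ae lebesgue_measure, forall t : R, t \in `]0, T[ -> U (u t)}.

(* L^2_loc(0,+oo;U), with square integrability up to the initial time 0. *)
Definition L2loc_control (R : realType) (m : nat) (U : set 'cV[R]_m)
    (u : R -> 'cV[R]_m) : Prop :=
  forall T : R, 0 < T -> admissible_control U T u.

(* Caratheodory solution on [0,T] of y' = A y + B u, y(0) = x. Integrability of
   the right-hand side makes every such y absolutely continuous, with the
   differential equation satisfied almost everywhere. *)
Definition trajectory (R : realType) (n m : nat) (A : 'M[R]_n)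
    (B : 'M[R]_(n, m)) (T : R) (x : 'cV[R]_n)
    (u : R -> 'cV[R]_m) (y : R -> 'cV[R]_n) : Prop :=
  forall i : 'I_n,
    lebesgue_measure.-integrable `[0, T]
      (fun s : R => ((A *m y s + B *m u s) i 0)%:E) /\
    forall t : R, t \in `[0, T] ->
      y t i 0 = x i 0 +
        \int[lebesgue_measure]_(s in `[0, t]) (A *m y s + B *m u s) i 0.

Definition global_trajectory (R : realType) (n m : nat) (A : 'M[R]_n)
    (B : 'M[R]_(n, m)) (x : 'cV[R]_n)
    (u : R -> 'cV[R]_m) (y : R -> 'cV[R]_n) : Prop :=
  forall T : R, 0 < T -> trajectory A B T x u y.

(* J_{T,x}(u), as a function of u and of its associated trajectory y. *)
Definition cost (R : realType) (n m : nat) (C : 'M[R]_n) (z : 'cV[R]_n)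
    (g : 'cV[R]_n -> R) (T : R)
    (u : R -> 'cV[R]_m) (y : R -> 'cV[R]_n) : \bar R :=
  ((2^-1)%:E * \int[lebesgue_measure]_(s in `]0%R, T[)
      (enorm (u s) ^+ 2 + enorm (C *m y s - z) ^+ 2)%:E
   + (g (y T))%:E)%E.

Definition optimal (R : realType) (n m : nat) (A : 'M[R]_n)
    (B : 'M[R]_(n, m)) (C : 'M[R]_n) (z : 'cV[R]_n) (U : set 'cV[R]_m)
    (g : 'cV[R]_n -> R) (T : R) (x : 'cV[R]_n)
    (u : R -> 'cV[R]_m) (y : R -> 'cV[R]_n) : Prop :=
  [/\ admissible_control U T u, trajectory A B T x u y &
      forall (v : R -> 'cV[R]_m) (w : R -> 'cV[R]_n),
        admissible_control U T v -> trajectory A B T x v w ->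
        (cost C z g T u y <= cost C z g T v w)%E].

Definition steady_cost (R : realType) (n m : nat) (C : 'M[R]_n)
    (z : 'cV[R]_n) (u : 'cV[R]_m) (y : 'cV[R]_n) : R :=
  2^-1 * (enorm u ^+ 2 + enorm (C *m y - z) ^+ 2).

Definition steady_set (R : realType) (n m : nat) (A : 'M[R]_n)
    (B : 'M[R]_(n, m)) (U : set 'cV[R]_m) : set ('cV[R]_m * 'cV[R]_n) :=
  [set p | U p.1 /\ A *m p.2 + B *m p.1 = 0].

Definition steady_minimizer (R : realType) (n m : nat) (A : 'M[R]_n)
    (B : 'M[R]_(n, m)) (C : 'M[R]_n) (z : 'cV[R]_n) (U : set 'cV[R]_m)
    (u : 'cV[R]_m) (y : 'cV[R]_n) : Prop :=
  steady_set A B U (u, y) /\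
  forall (v : 'cV[R]_m) (w : 'cV[R]_n), steady_set A B U (v, w) ->
    steady_cost C z u y <= steady_cost C z v w.

Definition norm_L1L2 (R : realType) (k : nat) (f : R -> 'cV[R]_k) : \bar R :=
  (Lnorm_on 1%:E `]0%R, +oo[ f + Lnorm_on 2%:E `]0%R, +oo[ f)%E.

Definition stabilizable_to_from (R : realType) (n m : nat) (A : 'M[R]_n)
    (B : 'M[R]_(n, m)) (U : set 'cV[R]_m) (K : R)
    (u1 : R -> 'cV[R]_m) (y1 : R -> 'cV[R]_n) (x : 'cV[R]_n) : Prop :=
  exists (u : R -> 'cV[R]_m) (y : R -> 'cV[R]_n),
    [/\ L2loc_control U u,
        global_trajectory A B x u y,
        in_Lp 1%:E `]0, +oo[ (u \- u1) /\ in_Lp 2%:E `]0, +oo[ (u \- u1),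
        in_Lp 1%:E `]0, +oo[ (y \- y1) /\ in_Lp 2%:E `]0, +oo[ (y \- y1) &
        (norm_L1L2 (u \- u1)%R + norm_L1L2 (y \- y1)%R
           <= (K * enorm (y1 0%R - x))%:E)%E].

Definition stabilizable (R : realType) (n m : nat) (A : 'M[R]_n)
    (B : 'M[R]_(n, m)) (U : set 'cV[R]_m) : Prop :=
  exists K : R, forall (u1 : R -> 'cV[R]_m) (y1 : R -> 'cV[R]_n),
    L2loc_control U u1 -> global_trajectory A B (y1 0) u1 y1 ->
    forall x : 'cV[R]_n, stabilizable_to_from A B U K u1 y1 x.

Definition detectable (R : realType) (n : nat) (A C : 'M[R]_n) : Prop :=
  exists L : 'M[R]_n, forall lambda : R[i],
    eigenvalue (map_mx (real_complex R) (A + L *m C)) lambda ->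
    complex.Re lambda < 0.

(* Main.v *)
Require Import Defs.
From HB Require Import structures.
From mathcomp Require Import all_boot all_order all_algebra.
From mathcomp Require Import all_classical all_reals all_analysis.
From mathcomp Require Import mxred spectral measurable_realfun complex ring lra.

(** The deviation from the steady optimum is written v = u - ubar and
    e = y - ybar.

    Since A is invertible, the first-order condition of the steady problem has a
    multiplier p with A^T p = - C^T (C ybar - z), and ubar + B^T p is nonnegative
    on U - ubar ([steady_variational]).  Expanding the running cost around
    (ubar, ybar) and using y' = A e + B v, one sees that its linear part is a
    nonnegative term minus the derivative of p . y.  Hence ([dissipation]) the
    cost over [a, b] is at least (b - a) times the steady cost, plus half the
    integral of |v|^2 + |C e|^2, minus p . (y(b) - y(a)).  Conversely,
    stabilizability to the constant trajectory ybar yields an admissible pair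
    whose cost over [0, T] exceeds T times the steady cost by a constant only.
    So an optimal pair has |v|^2 + |C e|^2 integrable uniformly in T, up to the
    boundary term p . y(T).

    Detectability provides a quadratic Lyapunov function for A + L C
    ([lyapunov]), and with it a bound of |e(b)|^2 and of the integral of |e|^2 by
    |e(a)|^2 and the integral of |v|^2 + |C e|^2 ([detectable_estimate]).  This
    absorbs the boundary term and gives the integral turnpike estimate
    ([optimal_a_priori_bound]).

    For the pointwise estimate, the integral bound forces |e| to be small at a
    time t1 of the first segment of length tau and at a time t2 of the last one.
    From t1 on, the optimal pair is compared with one that follows the steady
    pair until t2 and then the optimal pair itself; both exist by
    stabilizability, the second use being for the optimal trajectory prolonged
    beyond T.  The loss is small with |e(t1)| and |e(t2)|, so that dissipation
    makes the integral of |v|^2 + |C e|^2 over [t1, t2] small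
    ([optimal_middle_excess]), and detectability started at t1 makes e small on
    all of [t1, t2] ([turnpike_property]).

    Trajectories are primitives of integrable functions.  The product rule for
    them ([primitiveM]), on which the Lyapunov argument rests, is proved without
    differentiation, by estimating the defect over short intervals. *)

Set Implicit Arguments.
Unset Strict Implicit.
Unset Printing Implicit Defensive.

Import Order.TTheory GRing.Theory Num.Theory.
Import numFieldNormedType.Exports.

Local Open Scope classical_set_scope.
Local Open Scope ring_scope.

(** * Inner product and norm of column vectors *)

Section euclid.
Context (R : realType).

Definition dot k (v w : 'cV[R]_k) : R := \sum_i v i 0 * w i 0.

Lemma dotC k (v w : 'cV[R]_k) : dot v w = dot w v.
Proof. by apply: eq_bigr => i _; rewrite mulrC. Qed.

Lemma dotDr k (u v w : 'cV[R]_k) : dot u (v + w) = dot u v + dot u w.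
Proof. by rewrite -big_split; apply: eq_bigr => i _; rewrite mxE mulrDr. Qed.

Lemma dotZr k a (v w : 'cV[R]_k) : dot v (a *: w) = a * dot v w.
Proof. by rewrite mulr_sumr; apply: eq_bigr => i _; rewrite mxE mulrCA. Qed.

Lemma dotNr k (v w : 'cV[R]_k) : dot v (- w) = - dot v w.
Proof. by rewrite -scaleN1r dotZr mulN1r. Qed.

Lemma dotBr k (u v w : 'cV[R]_k) : dot u (v - w) = dot u v - dot u w.
Proof. by rewrite dotDr dotNr. Qed.

Lemma dotDl k (u v w : 'cV[R]_k) : dot (v + w) u = dot v u + dot w u.
Proof. by rewrite !(dotC _ u) dotDr. Qed.

Lemma dotZl k a (v w : 'cV[R]_k) : dot (a *: w) v = a * dot w v.
Proof. by rewrite !(dotC _ v) dotZr. Qed.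

Lemma dotNl k (v w : 'cV[R]_k) : dot (- w) v = - dot w v.
Proof. by rewrite !(dotC _ v) dotNr. Qed.

Lemma dotBl k (u v w : 'cV[R]_k) : dot (v - w) u = dot v u - dot w u.
Proof. by rewrite !(dotC _ u) dotBr. Qed.

Lemma dot0r k (v : 'cV[R]_k) : dot v 0 = 0.
Proof. by rewrite -(scale0r 0) dotZr mul0r. Qed.

Lemma dot_ge0 k (v : 'cV[R]_k) : 0 <= dot v v.
Proof. by apply: sumr_ge0 => i _; rewrite -expr2 sqr_ge0. Qed.

Lemma dot_mulmxr k l (M : 'M[R]_(k, l)) v w : dot v (M *m w) = dot (M^T *m v) w.
Proof.
rewrite /dot; under eq_bigr do rewrite mxE mulr_sumr.
rewrite exchange_big; apply: eq_bigr => j _ /=; rewrite mxE mulr_suml.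
by apply: eq_bigr => i _; rewrite mxE; ring.
Qed.

Lemma dot_mulmxl k l (M : 'M[R]_(k, l)) v w : dot (M *m v) w = dot v (M^T *m w).
Proof. by rewrite dotC dot_mulmxr dotC. Qed.

Lemma enorm_ge0 k (v : 'cV[R]_k) : 0 <= enorm v.
Proof. exact: sqrtr_ge0. Qed.

Lemma sqr_enorm k (v : 'cV[R]_k) : enorm v ^+ 2 = dot v v.
Proof.
rewrite /enorm; under eq_bigr do rewrite expr2.
by rewrite sqr_sqrtr// dot_ge0.
Qed.

(** Expand |a v - w|^2 >= 0 and divide by a. *)
Lemma dot_young k (a : R) (v w : 'cV[R]_k) : 0 < a ->
  2 * dot v w <= a * dot v v + dot w w / a.
Proof.
move=> a0; have := dot_ge0 (a *: v - w).
rewrite dotBl !dotBr !dotZl !dotZr (dotC w v) => h.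
rewrite -subr_ge0; have -> : a * dot v v + dot w w / a - 2 * dot v w =
   (a * (a * dot v v) - a * dot v w - (a * dot v w - dot w w)) / a.
  by field; rewrite gt_eqF.
by rewrite divr_ge0// ltW.
Qed.

(** Expand | |w|^2 v - (v . w) w |^2 >= 0 and divide by |w|^2. *)
Lemma dot_cauchy k (v w : 'cV[R]_k) : `|dot v w| <= enorm v * enorm w.
Proof.
rewrite -ler_sqr ?nnegrE ?mulr_ge0 ?enorm_ge0// real_normK ?num_real//.
rewrite exprMn !sqr_enorm.
have [w0|] := eqVneq (dot w w) 0.
  have : w = 0.
    apply/matrixP => i j; rewrite ord1 mxE; apply/eqP.
    move/eqP: w0; rewrite psumr_eq0 => [/allP/(_ i)|l _];
      last by rewrite -expr2 sqr_ge0.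
    by rewrite mem_index_enum -expr2 sqrf_eq0 => /(_ isT).
  by move=> ->; rewrite !dot0r expr0n mulr0.
move=> w0; have {}w0 : 0 < dot w w by rewrite lt_def w0 dot_ge0.
have := dot_ge0 (dot w w *: v - dot v w *: w).
rewrite dotBl !dotBr !dotZl !dotZr (dotC w v) => h.
by rewrite -subr_ge0 -(pmulr_rge0 _ w0); lra.
Qed.

Lemma enormD k (v w : 'cV[R]_k) : enorm (v + w) <= enorm v + enorm w.
Proof.
rewrite -ler_sqr ?nnegrE ?addr_ge0 ?enorm_ge0// sqr_enorm sqrrD !sqr_enorm.
rewrite dotDl !dotDr (dotC w v).
have := le_trans (ler_norm _) (dot_cauchy v w); lra.
Qed.

Lemma enormN k (v : 'cV[R]_k) : enorm (- v) = enorm v.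
Proof. by rewrite /enorm; congr Num.sqrt; apply: eq_bigr => i _;
  rewrite mxE sqrrN. Qed.

Lemma enormB k (v w : 'cV[R]_k) : enorm (v - w) <= enorm v + enorm w.
Proof. by rewrite -(enormN w); exact: enormD. Qed.

Lemma coord_le_enorm k (v : 'cV[R]_k) i : `|v i 0| <= enorm v.
Proof.
rewrite -ler_sqr ?nnegrE ?enorm_ge0// real_normK ?num_real// sqr_enorm.
rewrite /dot (bigD1 i)//= expr2 lerDl sumr_ge0// => j _.
by rewrite -expr2 sqr_ge0.
Qed.

Lemma enorm_le_sum k (v : 'cV[R]_k) : enorm v <= \sum_i `|v i 0|.
Proof.
rewrite -ler_sqr ?nnegrE ?enorm_ge0 ?sumr_ge0// sqr_enorm expr2 mulr_suml.
apply: ler_sum => i _; rewrite -expr2 -real_normK ?num_real// expr2.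
by rewrite ler_wpM2l// (bigD1 i)//= lerDl sumr_ge0.
Qed.

Lemma enorm_mulmx k l (M : 'M[R]_(k, l)) :
  exists2 c : R, 0 <= c & forall v, enorm (M *m v) <= c * enorm v.
Proof.
exists (\sum_i \sum_j `|M i j|); first by rewrite sumr_ge0// => i _;
  rewrite sumr_ge0.
move=> v; rewrite (le_trans (enorm_le_sum _))// mulr_suml.
apply: ler_sum => i _; rewrite mxE (le_trans (ler_norm_sum _ _ _))// mulr_suml.
apply: ler_sum => j _; rewrite normrM ler_wpM2l//.
exact: coord_le_enorm.
Qed.

Lemma dot_mulmx_le k l (M : 'M[R]_(k, l)) :
  exists2 c : R, 0 <= c & forall v, dot (M *m v) (M *m v) <= c * dot v v.
Proof.
have [c c0 Mc] := enorm_mulmx M; exists (c ^+ 2); first exact: sqr_ge0.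
move=> v; rewrite -!sqr_enorm -exprMn ler_sqr ?nnegrE ?mulr_ge0 ?enorm_ge0//.
Qed.

Lemma dotD_le k (v w : 'cV[R]_k) : dot (v + w) (v + w) <=
  2 * dot v v + 2 * dot w w.
Proof.
have := dot_ge0 (v - w).
by rewrite !(dotBl, dotBr, dotDl, dotDr) (dotC w v); lra.
Qed.

End euclid.

(** * Integrals over half-open intervals *)

(** Half-open intervals split at an interior point without overlap, so that no
    endpoint has to be discarded.  The constant is locked to keep conversion
    from unfolding the Lebesgue integral. *)
HB.lock Definition int_oc (R : realType) (a b : R) (f : R -> R) : R :=
  \int[@lebesgue_measure R]_(s in `]a, b]) f s.

Section interval_integral.
Context (R : realType).
Implicit Types (a b c d s t k : R) (f g : R -> R).
Local Notation mu := (@lebesgue_measure R).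

Definition integrable_oc a b f : Prop := mu.-integrable `]a, b] (EFin \o f).

Lemma int_ocE a b f : int_oc a b f = \int[mu]_(s in `]a, b]) f s.
Proof. by rewrite int_oc.unlock. Qed.

Lemma integrable_oc_sub a b c d f : a <= c -> d <= b -> integrable_oc a b f ->
  integrable_oc c d f.
Proof.
move=> ac db; apply: integrableS => //.
by apply: subset_itv; rewrite bnd_simp.
Qed.

Lemma integrable_oc_meas a b f : integrable_oc a b f -> measurable_fun `]a, b] f.
Proof. by move=> /measurable_int/measurable_EFinP. Qed.

Lemma eq_integrable_oc a b f g : {in `]a, b], f =1 g} -> integrable_oc a b f ->
  integrable_oc a b g.
Proof.
move=> fg; apply: eq_integrable => // x; rewrite inE/= => xab.
by rewrite fg.
Qed.

Lemma integrable_ocD a b f g : integrable_oc a b f -> integrable_oc a b g ->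
  integrable_oc a b (fun s => f s + g s).
Proof.
by move=> If Ig; apply: eq_integrable (integrableD _ If Ig).
Qed.

Lemma integrable_ocZ a b k f : integrable_oc a b f ->
  integrable_oc a b (fun s => k * f s).
Proof.
by move=> If; apply: eq_integrable (integrableZl _ k If).
Qed.

Lemma integrable_ocB a b f g : integrable_oc a b f -> integrable_oc a b g ->
  integrable_oc a b (fun s => f s - g s).
Proof.
by move=> If Ig; apply: eq_integrable (integrableB _ If Ig).
Qed.

Lemma integrable_oc_norm a b f : integrable_oc a b f ->
  integrable_oc a b (fun s => `|f s|).
Proof. exact: integrable_norm. Qed.

Lemma integrable_oc_cst a b k : integrable_oc a b (fun=> k).
Proof.
apply/integrableP; split; first exact/measurable_EFinP.
rewrite (@integral_cst _ _ _ mu `]a, b] _ `|k%:E|)//= lebesgue_measure_itv/=.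
by case: ifP => _; rewrite -?EFinB ?mule0 -?EFinM ltry.
Qed.

Lemma integrable_oc_dom a b f g : measurable_fun `]a, b] f ->
  (forall s, a < s -> s <= b -> `|f s| <= g s) -> integrable_oc a b g ->
    integrable_oc a b f.
Proof.
move=> mf fg; apply: le_integrable => //; first exact/measurable_EFinP.
move=> s /=; rewrite in_itv/= => /andP[as_ sb].
by rewrite lee_fin (le_trans (fg _ as_ sb))// ler_norm.
Qed.

Lemma int_ocD a b f g : integrable_oc a b f -> integrable_oc a b g ->
  int_oc a b (fun s => f s + g s) = int_oc a b f + int_oc a b g.
Proof. by move=> If Ig; rewrite !int_ocE; exact: RintegralD. Qed.

Lemma int_ocB a b f g : integrable_oc a b f -> integrable_oc a b g ->
  int_oc a b (fun s => f s - g s) = int_oc a b f - int_oc a b g.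
Proof. by move=> If Ig; rewrite !int_ocE; exact: RintegralB. Qed.

Lemma int_ocZ a b k f : integrable_oc a b f ->
  int_oc a b (fun s => k * f s) = k * int_oc a b f.
Proof. by move=> If; rewrite !int_ocE; exact: RintegralZl. Qed.

Lemma eq_int_oc a b f g : (forall s, a < s -> s <= b -> f s = g s) ->
  int_oc a b f = int_oc a b g.
Proof.
by move=> fg; rewrite !int_ocE; apply: eq_Rintegral => s;
  rewrite inE/= in_itv => /andP[]; exact: fg.
Qed.

Lemma int_oc_cst a b k : a <= b -> int_oc a b (fun=> k) = k * (b - a).
Proof.
move=> ab; rewrite !int_ocE Rintegral_cst//= lebesgue_measure_itv/= lte_fin.
case: ltP => //= ba; suff -> : b = a by rewrite subrr.
by apply/eqP; rewrite eq_le ba.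
Qed.

Lemma le_int_oc a b f g : integrable_oc a b f -> integrable_oc a b g ->
  (forall s, a < s -> s <= b -> f s <= g s) -> int_oc a b f <= int_oc a b g.
Proof.
move=> If Ig fg; rewrite !int_ocE; apply: le_Rintegral => // s /=.
by rewrite in_itv/= => /andP[]; exact: fg.
Qed.

Lemma int_oc_ge0 a b f : (forall s, a < s -> s <= b -> 0 <= f s) ->
  0 <= int_oc a b f.
Proof.
by move=> f0; rewrite int_ocE; apply: Rintegral_ge0 => s /=;
  rewrite in_itv/= => /andP[]; exact: f0.
Qed.

Lemma int_oc_norm a b f : integrable_oc a b f ->
  `|int_oc a b f| <= int_oc a b (fun s => `|f s|).
Proof. by move=> If; rewrite !int_ocE; exact: le_normr_Rintegral. Qed.

Lemma ae_imply (P Q : R -> Prop) : (forall s, P s -> Q s) ->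
  {ae mu, forall s, P s} -> {ae mu, forall s, Q s}.
Proof.
move=> PQ [N [mN N0 PN]]; exists N; split => // s /= nQ.
by apply: PN => /= Ps; apply/nQ/PQ.
Qed.

Lemma ae_and (P Q : R -> Prop) : {ae mu, forall s, P s} ->
  {ae mu, forall s, Q s} -> {ae mu, forall s, P s /\ Q s}.
Proof.
move=> [N1 [m1 z1 s1]] [N2 [m2 z2 s2]]; exists (N1 `|` N2); split.
- exact: measurableU.
- exact: null_set_setU.
- move=> s /= nPQ; have [Ps|] := pselect (P s); last by left; exact: s1.
  by right; apply: s2 => Qs; exact: nPQ.
Qed.

Lemma ae_neq b : {ae mu, forall s, s != b}.
Proof.
exists [set b]; split => //; first exact: lebesgue_measure_set1.
by move=> s /= /negP; rewrite negbK => /eqP.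
Qed.

(** Such a function has the same integral as its absolute value, the endpoint b
    being a null set. *)
Lemma ae_int_oc_ge0 a b f : integrable_oc a b f ->
  {ae mu, forall s, s \in `]a, b[ -> 0 <= f s} -> 0 <= int_oc a b f.
Proof.
move=> If f0.
have IS g : integrable_oc a b g -> mu.-integrable `]a, b[ (EFin \o g).
  by apply: integrableS => //; apply: subset_itv; rewrite bnd_simp.
have oo g : integrable_oc a b g -> int_oc a b g = \int[mu]_(s in `]a, b[) g s.
  by move=> /IS Ig; rewrite int_ocE Rintegral_itv_bndo_bndc.
suff E : int_oc a b f = int_oc a b (fun s => `|f s|) by rewrite E;
  apply: int_oc_ge0.
rewrite !oo//; last exact: integrable_oc_norm.
congr fine; apply: ae_eq_integral => //.
- by case/integrableP: (IS _ If).
- by case/integrableP: (IS _ (integrable_oc_norm If)).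
- by apply: ae_imply f0 => s /= fs sab; rewrite ger0_norm// fs.
Qed.

Lemma int_oc_chasles a b c f : a <= b -> b <= c -> integrable_oc a c f ->
  int_oc a c f = int_oc a b f + int_oc b c f.
Proof.
move=> ab bc If.
have E : `]a, c]%classic = `]a, b] `|` `]b, c] :> set R.
  by rewrite -itv_bndbnd_setU// bnd_simp.
rewrite !int_ocE E Rintegral_setU// -?E//.
apply/disj_set2P; rewrite -subset0 => z/=; rewrite !in_itv/= => -[/andP[_ zb]].
by rewrite ltNge zb.
Qed.

Lemma integrable_oc_cat a b c f : a <= b -> b <= c -> integrable_oc a b f ->
  integrable_oc b c f -> integrable_oc a c f.
Proof.
move=> ab bc If Ig; rewrite /integrable_oc (@itv_bndbnd_setU _ _ _ (BRight b))
  ?bnd_simp//.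
apply/integrableP; split.
  apply/(measurable_funU _ _ _).2 => //; split.
    by move: If => /(measurable_int mu).
  by move: Ig => /(measurable_int mu).
rewrite ge0_integral_setU//=.
- by case/integrableP: If => _ If; case/integrableP: Ig => _ Ig;
  exact: lte_add_pinfty.
- apply/measurable_EFinP; apply: measurableT_comp => //.
  apply/(measurable_funU _ _ _).2 => //; split; exact: integrable_oc_meas.
- apply/disj_set2P; rewrite -subset0 => z/=; rewrite !in_itv/= => -[/andP[_ zb]].
  by rewrite ltNge zb.
Qed.

Lemma int_oc_pt a f : int_oc a a f = 0.
Proof. by rewrite !int_ocE set_itv_ge ?Rintegral_set0// bnd_simp ltxx. Qed.

End interval_integral.

(** * Translation of the integration variable *)

Section shift.
Context (R : realType).
Implicit Types (a b c k s t : R) (f g : R -> R).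
Local Notation mu := (@lebesgue_measure R).

Definition translate k : measurableTypeR R -> measurableTypeR R :=
  fun s => s + k.

Lemma measurable_translate k : measurable_fun setT (translate k).
Proof. exact: measurable_funD. Qed.

#[local] Hint Resolve measurable_translate : core.

(** The two measures agree on the intervals ]a, b], which generate the Borel
    sets. *)
Lemma lebesgue_measure_shift k (A : set (measurableTypeR R)) :
  measurable A -> mu A = pushforward mu (translate k) A.
Proof.
move=> mA; apply: lebesgue_measure_unique => // X [[a b] _ <-] /=.
rewrite /pushforward (_ : translate k @^-1` _ = `]a - k, b - k]%classic);
  last first.
  by apply/seteqP; split => s; rewrite /translate /= !in_itv/= ltrBlDr lerBrDr.
rewrite !lebesgue_measure_itv/= !lte_fin ltrD2r.
by case: ifP => //; rewrite -!EFinB opprB addrA subrK.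
Qed.

Lemma preimage_translate a b k : translate (- k) @^-1` `]a, b] =
  `]a + k, b + k]%classic.
Proof.
by apply/seteqP; split => s /=; rewrite /translate !in_itv/= ltrBrDr lerBlDr.
Qed.

Lemma integrable_oc_shift a b k f : integrable_oc a b f ->
  integrable_oc (a + k) (b + k) (fun s => f (s - k)).
Proof.
move=> If; rewrite /integrable_oc -preimage_translate; apply/integrableP; split.
  apply: (measurable_comp (F := `]a, b]%classic) (f := EFin \o f) (g :=
    translate (- k))) => //.
  - by move=> _ [s /= ? <-].
  - exact: (measurable_int mu).
  - by apply: measurable_funTS; exact: (measurable_translate (- k)).
have /integrableP[mf] := If.
apply: le_lt_trans; rewrite -(ge0_integral_pushforward (measurable_translate (-
  k)) mu (f := fun s => `|(f s)%:E|%E)) => //.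
- rewrite (eq_measure_integral mu)// => A mA _.
  by rewrite [RHS](lebesgue_measure_shift (- k)).
- exact: measurableT_comp.
Qed.

Lemma int_oc_shift a b k f : integrable_oc a b f ->
  int_oc (a + k) (b + k) (fun s => f (s - k)) = int_oc a b f.
Proof.
move=> If; rewrite !int_ocE -preimage_translate.
rewrite /Rintegral; congr fine.
pose F := (EFin \o f) \_ `]a, b].
have mF : measurable_fun setT F.
  by apply/measurable_restrict => //; rewrite setTI; exact: (measurable_int mu).
have := integral_pushforward (measurable_translate (- k)) (mu := mu) (D :=
  `]a, b]%classic) mF.
have IF : mu.-integrable (translate (- k) @^-1` `]a, b]) (F \o translate (- k)).
  have := integrable_oc_shift k If; rewrite /integrable_oc -preimage_translate;
    apply: eq_integrable.
    by rewrite preimage_translate.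
  by move=> s; rewrite inE/= => sab; rewrite /F patchE ifT// inE.
move=> /(_ IF (measurable_itv _)).
rewrite [X in X = _ -> _](eq_measure_integral mu); last first.
  by move=> A mA _; rewrite [RHS](lebesgue_measure_shift (- k)).
have -> : (\int[mu]_(x in `]a, b]) F x = \int[mu]_(x in `]a, b]) (f x)%:E)%E.
  by apply: eq_integral => s sab; rewrite /F patchE sab.
move=> ->; apply: eq_integral => s; rewrite inE/= => sab.
by rewrite /F patchE ifT// inE.
Qed.

Lemma ae_shift k (P : R -> Prop) : {ae mu, forall s, P s} ->
  {ae mu, forall s, P (s - k)}.
Proof.
move=> [N [mN N0 PN]]; exists (translate (- k) @^-1` N); split.
- by rewrite -[X in measurable X]setTI; exact: (measurable_translate (- k)).
- by rewrite -[LHS]/(pushforward mu (translate (- k)) N) -lebesgue_measure_shift.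
- by move=> s /= nP; exact: PN.
Qed.

End shift.

(** * Primitives of integrable functions *)

Section primitive.
Context (R : realType).
Implicit Types (a b c k s t : R) (e f g : R -> R).
Local Notation mu := (@lebesgue_measure R).

Lemma integrable_oc_cc a b f : integrable_oc a b f <->
  mu.-integrable `[a, b] (EFin \o f).
Proof.
split; last first.
  by apply: integrableS => //; apply: subset_itv; rewrite bnd_simp.
move=> /integrableP[mf If]; apply/integrableP; split.
  exact/emeasurable_fun_itv_obnd_cbndP.
by rewrite -integral_itv_obnd_cbnd//; exact: measurableT_comp.
Qed.

Lemma integrable_oc_oo a b f : integrable_oc a b f <->
  mu.-integrable `]a, b[ (EFin \o f).
Proof.
split.
  by apply: integrableS => //; apply: subset_itv; rewrite bnd_simp.
move=> /integrableP[mf If]; apply/integrableP; split.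
  exact/emeasurable_fun_itv_bndo_bndcP.
by rewrite -integral_itv_bndo_bndc//; exact: measurableT_comp.
Qed.

Lemma int_oc_cc a b f : integrable_oc a b f ->
  \int[mu]_(s in `[a, b]) f s = int_oc a b f.
Proof. by move=> If; rewrite int_ocE -Rintegral_itv_obnd_cbnd. Qed.

Lemma int_oc_oo a b f : integrable_oc a b f ->
  \int[mu]_(s in `]a, b[) f s = int_oc a b f.
Proof. by move=> /integrable_oc_oo If;
  rewrite int_ocE Rintegral_itv_bndo_bndc. Qed.

Lemma int_oc_EFin a b f : integrable_oc a b f ->
  (\int[mu]_(s in `]a, b[) (f s)%:E)%E = (int_oc a b f)%:E.
Proof.
move=> If; rewrite -int_oc_oo// /Rintegral fineK//.
by apply: integrable_fin_num => //; apply/integrable_oc_oo.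
Qed.

Lemma int_oc_continuous a b f : a <= b -> integrable_oc a b f ->
  {within `[a, b], continuous (fun t => int_oc a t f)}.
Proof.
move=> ab If.
have := parameterized_integral_continuous ab ((integrable_oc_cc _ _ _).1 If).
apply: subspace_eq_continuous => t; rewrite inE/= in_itv/= => /andP[at_ tb].
by rewrite /from_subspace/= /parameterized_integral int_oc_cc//;
  exact: integrable_oc_sub If.
Qed.

(** Caratheodory form of the equation e' = f on [a, b]. *)
Definition primitive a b e f : Prop :=
  integrable_oc a b f /\ forall t, a <= t -> t <= b -> e t = e a + int_oc a t f.

Lemma primitive_diff a b e f s t : primitive a b e f ->
  a <= s -> s <= t -> t <= b -> e t - e s = int_oc s t f.
Proof.
move=> [If ef] as_ st tb.
rewrite ef ?(le_trans as_ st)// (ef s)// ?(le_trans st tb)//.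
rewrite (int_oc_chasles as_ st); first by ring.
by apply: integrable_oc_sub If.
Qed.

Lemma primitive_sub a b c d e f : a <= c -> d <= b ->
  primitive a b e f -> primitive c d e f.
Proof.
move=> ac db p; split; first by apply: integrable_oc_sub p.1.
move=> t ct td.
by rewrite -(primitive_diff p ac ct) ?(le_trans td db)//; ring.
Qed.

Lemma eq_primitive a b e1 e2 f1 f2 :
  (forall t, a <= t -> t <= b -> e1 t = e2 t) ->
  (forall t, a < t -> t <= b -> f1 t = f2 t) ->
  primitive a b e1 f1 -> primitive a b e2 f2.
Proof.
move=> e12 f12 [If ef]; split.
  by apply: eq_integrable_oc If => t; rewrite in_itv/= => /andP[]; exact: f12.
move=> t at_ tb; rewrite -e12// ef// e12 ?(le_trans at_ tb)//.
by congr (_ + _); apply: eq_int_oc => s as_ st; rewrite f12// (le_trans st tb).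
Qed.

Lemma primitive_cst a b k : primitive a b (fun=> k) (fun=> 0).
Proof.
split; first exact: integrable_oc_cst.
by move=> t at_ tb; rewrite int_oc_cst// mul0r addr0.
Qed.

Lemma primitiveD a b e1 e2 f1 f2 : primitive a b e1 f1 -> primitive a b e2 f2 ->
  primitive a b (fun t => e1 t + e2 t) (fun t => f1 t + f2 t).
Proof.
move=> [If1 ef1] [If2 ef2]; split; first exact: integrable_ocD.
move=> t at_ tb; rewrite ef1// ef2// int_ocD; first ring.
  exact: integrable_oc_sub If1.
exact: integrable_oc_sub If2.
Qed.

Lemma primitiveZ a b k e f : primitive a b e f ->
  primitive a b (fun t => k * e t) (fun t => k * f t).
Proof.
move=> [If ef]; split; first exact: integrable_ocZ.
move=> t at_ tb; rewrite ef// int_ocZ ?mulrDr//.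
exact: integrable_oc_sub If.
Qed.

Lemma primitiveB a b e1 e2 f1 f2 : primitive a b e1 f1 -> primitive a b e2 f2 ->
  primitive a b (fun t => e1 t - e2 t) (fun t => f1 t - f2 t).
Proof.
move=> p1 p2; have := primitiveD p1 (primitiveZ (-1) p2).
by apply: eq_primitive => t _ _; rewrite mulN1r.
Qed.

Lemma primitive_sum (I : eqType) (r : seq I) a b (e f : I -> R -> R) :
  (forall i, primitive a b (e i) (f i)) ->
  primitive a b (fun t => \sum_(i <- r) e i t) (fun t => \sum_(i <- r) f i t).
Proof.
move=> ef; elim: r => [|i r IH].
  by apply: eq_primitive (primitive_cst a b 0) => t _ _; rewrite big_nil.
by apply: eq_primitive (primitiveD (ef i) IH) => t _ _; rewrite big_cons.
Qed.

Lemma primitive_shift a b k e f : primitive a b e f ->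
  primitive (a + k) (b + k) (fun t => e (t - k)) (fun t => f (t - k)).
Proof.
move=> [If ef]; split; first exact: integrable_oc_shift.
move=> t at_ tb; rewrite ef ?lerBrDr ?lerBlDr// addrK; congr (_ + _).
rewrite -(@int_oc_shift _ a (t - k) k) ?subrK//.
by apply: integrable_oc_sub If; rewrite // lerBlDr.
Qed.

Lemma primitive_cat a b c e f : a <= b -> b <= c ->
  primitive a b e f -> primitive b c e f -> primitive a c e f.
Proof.
move=> ab bc [If ef] [Ig eg]; have Iac := integrable_oc_cat ab bc If Ig.
split=> // t at_ tc; have [tb|bt] := leP t b; first exact: ef.
rewrite eg// ?(ltW bt)// ef// -addrA -int_oc_chasles// ?ltW//.
exact: integrable_oc_sub Iac.
Qed.

Lemma primitive_bound a b e f t : primitive a b e f -> a <= t -> t <= b ->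
  `|e t| <= `|e a| + int_oc a b (fun s => `|f s|).
Proof.
move=> [If ef] at_ tb; rewrite ef// (le_trans (ler_normD _ _))// lerD2l.
rewrite (le_trans (int_oc_norm _))//; first exact: integrable_oc_sub If.
rewrite [leRHS](int_oc_chasles at_ tb); last exact: integrable_oc_norm.
by rewrite lerDl; apply: int_oc_ge0.
Qed.

Lemma primitive_continuous a b e f : a <= b -> primitive a b e f ->
  {within `[a, b], continuous e}.
Proof.
move=> ab [If ef].
have cI : {within `[a, b], continuous (fun t => e a + int_oc a t f)}.
  move=> t; apply: cvgD; first exact: cvg_cst.
  exact: (int_oc_continuous ab If).
apply: subspace_eq_continuous cI => t; rewrite inE/= in_itv/= => /andP[at_ tb].
exact/esym/ef.
Qed.

Lemma primitive_measurable a b e f : primitive a b e f ->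
  measurable_fun `]a, b] e.
Proof.
move=> p; have [ab|ba] := leP a b; last first.
  by rewrite set_itv_ge ?bnd_simp -?leNgt ?(ltW ba)//; exact: measurable_fun_set0.
have : measurable_fun `[a, b] e.
  apply: subspace_continuous_measurable_fun => //.
  exact: primitive_continuous p.
by apply: measurable_funS => //; apply: subset_itv; rewrite bnd_simp.
Qed.

Lemma integrable_oc_primitiveM a b e f g : primitive a b e f ->
  integrable_oc a b g ->
  integrable_oc a b (fun t => e t * g t).
Proof.
move=> p Ig.
apply: (@integrable_oc_dom _ _ _ _ (fun t =>
  (`|e a| + int_oc a b (fun s => `|f s|)) * `|g t|)).
- by apply: measurable_funM; [exact: primitive_measurable p|exact:
  integrable_oc_meas].
- move=> t at_ tb; rewrite normrM ler_wpM2r//.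
  by rewrite (primitive_bound p)// ltW.
- exact/integrable_ocZ/integrable_oc_norm.
Qed.

Lemma integrable_oc_primitive a b e f : primitive a b e f -> integrable_oc a b e.
Proof.
move=> p; have := integrable_oc_primitiveM p (integrable_oc_cst a b 1).
by apply: eq_integrable_oc => t _; rewrite mulr1.
Qed.

(** Cut [a, b] at points where H takes the values k (H b) / N.  Each increment
    of P is then at most (H b / N)^2, so that |P b - P a| <= (H b)^2 / N for
    every N. *)
Let quadratic_variation a b (H P : R -> R) : a <= b ->
  {within `[a, b], continuous H} -> H a = 0 -> 0 <= H b ->
  (forall s t, a <= s -> s <= t -> t <= b -> `|P t - P s| <= (H t - H s) ^+ 2) ->
  P b = P a.
Proof.
move=> ab cH Ha Hb PH.
have {}PH s t : a <= s -> s <= b -> a <= t -> t <= b ->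
    `|P t - P s| <= (H t - H s) ^+ 2.
  move=> as_ sb at_ tb; have [st|/ltW ts] := leP s t; first exact: PH.
  by rewrite distrC -sqrrN opprB; exact: PH.
have step (N : nat) (k : nat) : (k <= N.+1)%N -> exists2 t, t \in `[a, b] &
    H t = k%:R * (H b / N.+1%:R) /\
    `|P t - P a| <= k%:R * (H b / N.+1%:R) ^+ 2.
  elim: k => [_|k IH kN].
    exists a; first by rewrite in_itv/= lexx.
    by rewrite subrr normr0 !mul0r.
  have [s] := IH (ltnW kN); rewrite in_itv/= => /andP[as_ sb] [Hs Ps].
  have hN : 0 <= H b / N.+1%:R by rewrite divr_ge0.
  have [|t tab Ht] := IVT (v := k.+1%:R * (H b / N.+1%:R)) ab cH.
    rewrite Ha min_l// max_r// mulr_ge0//= mulrCA ler_piMr//.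
    by rewrite ler_pdivrMr// mul1r ler_nat.
  exists t => //; split=> //; move: tab; rewrite in_itv/= => /andP[at_ tb].
  have -> : P t - P a = (P t - P s) + (P s - P a) by ring.
  rewrite (le_trans (ler_normD _ _))// [k.+1%:R]mulrS mulrDl mul1r lerD//.
  rewrite (le_trans (PH _ _ _ _ _ _))// Ht Hs.
  by rewrite mulrS mulrDl mul1r addrK.
have bound (N : nat) : `|P b - P a| <= H b ^+ 2 / N.+1%:R.
  have [t] := step N N.+1 (leqnn _); rewrite in_itv/= => /andP[at_ tb] [Ht Pt].
  have Htb : H t = H b by rewrite Ht mulrCA divff ?mulr1.
  have -> : P b - P a = (P b - P t) + (P t - P a) by ring.
  rewrite (le_trans (ler_normD _ _))//.
  have := PH t b at_ tb ab (lexx b); rewrite Htb subrr expr0n/= => Pbt.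
  rewrite -[leRHS]add0r lerD// (le_trans Pt)// le_eqVlt; apply/orP; left.
  by apply/eqP; field.
apply/eqP; rewrite -subr_eq0 -normr_le0 leNgt; apply/negP => P0.
pose N := Num.truncn (H b ^+ 2 / `|P b - P a|).
have := bound N; apply/negP; rewrite -ltNge ltr_pdivrMr// mulrC -ltr_pdivrMr//.
exact: Num.Theory.truncnS_gt.
Qed.

(** Let H be the integral of |f1| + |f2|.  Over [s, t] the product e1 e2 has
    increment equal to the integral of f1 e2(t) + e1(s) f2; replacing e2(t) and
    e1(s) by the running values changes it by at most (H t - H s)^2.  Such a
    defect vanishes by [quadratic_variation]. *)
Lemma primitiveM a b e1 e2 f1 f2 : primitive a b e1 f1 -> primitive a b e2 f2 ->
  primitive a b (fun t => e1 t * e2 t) (fun t => f1 t * e2 t + e1 t * f2 t).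
Proof.
have fin c d : primitive c d e1 f1 -> primitive c d e2 f2 ->
    integrable_oc c d (fun t => f1 t * e2 t + e1 t * f2 t).
  move=> p1 p2; apply: integrable_ocD;
    last exact: integrable_oc_primitiveM p1 p2.1.
  by apply: eq_integrable_oc (integrable_oc_primitiveM p2 p1.1) => t _;
    rewrite mulrC.
move=> p1 p2; split; first exact: fin.
move=> b' ab bb; have {p1} := primitive_sub (lexx a) bb p1.
have {p2} := primitive_sub (lexx a) bb p2 => {b bb}; move: b' ab => b ab p2 p1.
pose w t := `|f1 t| + `|f2 t|.
have Iw : integrable_oc a b w by apply: integrable_ocD;
  apply: integrable_oc_norm; [exact: p1.1|exact: p2.1].
pose P t := e1 t * e2 t - int_oc a t (fun t => f1 t * e2 t + e1 t * f2 t).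
suff : P b = P a by rewrite /P int_oc_pt subr0 => <-; rewrite subrK.
apply: (@quadratic_variation a b (fun t => int_oc a t w)) => //.
- exact: int_oc_continuous.
- exact: int_oc_pt.
- by apply: int_oc_ge0 => s _ _; rewrite addr_ge0.
move=> s t as_ st tb; have at_ := le_trans as_ st.
have q1 := primitive_sub as_ tb p1; have q2 := primitive_sub as_ tb p2.
have Iwst : integrable_oc s t w by exact: integrable_oc_sub Iw.
have Iwat : integrable_oc a t w by exact: integrable_oc_sub Iw.
have -> : int_oc a t w - int_oc a s w = int_oc s t w.
  by rewrite (int_oc_chasles as_ st)//; ring.
have W0 : 0 <= int_oc s t w by apply: int_oc_ge0 => r _ _; rewrite addr_ge0.
have -> : P t - P s = int_oc s t (fun r =>
  f1 r * (e2 t - e2 r) + (e1 s - e1 r) * f2 r).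
  have E : int_oc s t (fun r => f1 r * e2 t + e1 s * f2 r) =
    e1 t * e2 t - e1 s * e2 s.
    rewrite int_ocD; last 2 first.
      by apply: eq_integrable_oc (integrable_ocZ (e2 t) q1.1) => r _;
        rewrite mulrC.
      exact: integrable_ocZ q2.1.
    rewrite (int_ocZ _ q2.1) -(primitive_diff p2 as_ st tb).
    rewrite (eq_int_oc (g := fun r => e2 t * f1 r)); last by move=> r _ _;
      rewrite mulrC.
    by rewrite (int_ocZ _ q1.1) -(primitive_diff p1 as_ st tb); ring.
  rewrite (eq_int_oc (g := fun r => (f1 r * e2 t + e1 s * f2 r) -
      (f1 r * e2 r + e1 r * f2 r))); last by move=> r _ _; ring.
  rewrite int_ocB ?E; last 2 first.
    apply: integrable_ocD; last exact: integrable_ocZ q2.1.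
    by apply: eq_integrable_oc (integrable_ocZ (e2 t) q1.1) => r _; rewrite mulrC.
    exact: fin.
  rewrite /P (int_oc_chasles as_ st); first by ring.
  apply: fin; [exact: primitive_sub p1|exact: primitive_sub p2].
set h := (fun r => _).
have Ih : integrable_oc s t h.
  apply: integrable_ocD.
    have q := primitiveB (primitive_cst s t (e2 t)) q2.
    by apply: eq_integrable_oc (integrable_oc_primitiveM q q1.1) => r _;
      rewrite mulrC.
  have q := primitiveB (primitive_cst s t (e1 s)) q1.
  exact: (integrable_oc_primitiveM q q2.1).
rewrite (le_trans (int_oc_norm Ih))// expr2 -int_ocZ//.
apply: le_int_oc; [exact: integrable_oc_norm|exact: integrable_ocZ|move=> r sr
  rt].
have d1 : `|e1 s - e1 r| <= int_oc s t w.
  have p1r : primitive s r e1 f1 by exact: primitive_sub q1.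
  have := primitive_diff q1 (lexx s) (ltW sr) rt.
  rewrite distrC => ->; rewrite (le_trans (int_oc_norm p1r.1))//.
  rewrite [leRHS](int_oc_chasles (ltW sr) rt)// -[leLHS]addr0 lerD//; last first.
    by apply: int_oc_ge0 => x _ _; rewrite addr_ge0.
  apply: le_int_oc; [exact/integrable_oc_norm/p1r.1|exact: integrable_oc_sub
    Iwst|].
  by move=> x _ _; rewrite lerDl.
have d2 : `|e2 t - e2 r| <= int_oc s t w.
  have p2r : primitive r t e2 f2 by apply: primitive_sub q2 => //; exact: ltW.
  rewrite (primitive_diff q2 (ltW sr) rt (lexx t)) (le_trans (int_oc_norm
    p2r.1))//.
  rewrite [leRHS](int_oc_chasles (ltW sr) rt)// -[leLHS]add0r lerD//.
    by apply: int_oc_ge0 => x _ _; rewrite addr_ge0.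
  apply: le_int_oc; [exact/integrable_oc_norm/p2r.1|by apply: integrable_oc_sub
    Iwst => //; exact: ltW|].
  by move=> x _ _; rewrite lerDr.
rewrite /h (le_trans (ler_normD _ _))// !normrM /w mulrDr lerD//.
  by rewrite mulrC ler_wpM2r.
by rewrite ler_wpM2r.
Qed.

End primitive.

(** * Lyapunov functions of stable matrices *)

Section lyapunov.
Context (R : realType).
Local Open Scope complex_scope.

Definition sqmod (w : R[i]) : R := complex.Re w ^+ 2 + complex.Im w ^+ 2.

Let sqmod_ge0 w : 0 <= sqmod w.
Proof. by rewrite addr_ge0 ?sqr_ge0. Qed.

(** Re (conj v * w), the real inner product of the complex plane. *)
Definition redot (v w : R[i]) : R :=
  complex.Re v * complex.Re w + complex.Im v * complex.Im w.

Let redot_sum (v : R[i]) (I : Type) (r : seq I) (P : pred I) (F : I -> R[i]) :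
  redot v (\sum_(i <- r | P i) F i) = \sum_(i <- r | P i) redot v (F i).
Proof.
apply: (big_morph (redot v)); last by rewrite /redot/= !mulr0 addr0.
by move=> [a b] [c d]; rewrite /redot/=; ring.
Qed.

Let redotM (t w : R[i]) : redot w (t * w) = complex.Re t * sqmod w.
Proof. by case: t w => [a b] [c d]; rewrite /redot /sqmod/=; ring. Qed.

Let redot_young (k : R) (t v w : R[i]) : 0 < k ->
  redot v (t * w) <= 2^-1 * (k * sqmod v + sqmod t * sqmod w / k).
Proof.
move=> k0; case: t v w => [a b] [c d] [e f]; rewrite /redot /sqmod/=.
set p := a * e - b * f; set q := a * f + b * e.
have -> : (a ^+ 2 + b ^+ 2) * (e ^+ 2 + f ^+ 2) = p ^+ 2 + q ^+ 2.
  by rewrite /p /q; ring.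
rewrite -subr_ge0.
have -> : 2^-1 * (k * (c ^+ 2 + d ^+ 2) + (p ^+ 2 + q ^+ 2) / k) - (c * p + d * q)
    = 2^-1 * ((k * c - p) ^+ 2 + (k * d - q) ^+ 2) / k.
  by field; rewrite gt_eqF.
by rewrite divr_ge0 ?mulr_ge0 ?addr_ge0 ?sqr_ge0 ?ltW.
Qed.

(** A sub-diagonal entry T i j, j < i, couples coordinates of weights eta^i and
    eta^j, and eta^i <= eta * eta^j.  For small eta these couplings are dominated
    by the diagonal, whose real parts are at most - mu. *)
Lemma trig_lyapunov n (T : 'M[R[i]]_n) (mu : R) : is_trig_mx T -> 0 < mu ->
  (forall i, complex.Re (T i i) <= - mu) ->
  exists2 eta : R, 0 < eta <= 1 & forall w : 'cV[R[i]]_n,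
    \sum_(i < n) eta ^+ i * redot (w i 0) ((T *m w) i 0) <=
    - (mu / 4) * \sum_(i < n) eta ^+ i * sqmod (w i 0).
Proof.
move=> /is_trig_mxP trigT mu0 Tmu.
pose N : R := n%:R + 1.
have N0 : 0 < N by rewrite ltr_wpDl.
pose tau := \sum_i \sum_j sqmod (T i j) + 1.
have tau0 : 0 < tau by rewrite ltr_wpDl// !sumr_ge0// => i _; rewrite sumr_ge0.
have Ttau i j : sqmod (T i j) <= tau.
  have s0 (P : pred 'I_n) k : 0 <= \sum_(l | P l) sqmod (T k l) by rewrite
    sumr_ge0.
  apply: (@le_trans _ _ (\sum_j sqmod (T i j))).
    by rewrite [leRHS](bigD1 j)//= lerDl.
  rewrite /tau [X in _ <= X + 1](bigD1 i)//=.
  by rewrite -[leLHS]addr0 -[leRHS]addrA lerD2l addr_ge0// sumr_ge0.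
have Nn : n.+1%:R = N by rewrite -natr1.
have nN : n%:R <= N by rewrite lerDl.
have muW := ltW mu0; have NW := ltW N0; have tauW := ltW tau0.
clearbody N tau.
(* This eta makes the total coupling N * (eta * tau * N / (2 * mu)) at most
   mu / 4, out of the mu / 2 left on the diagonal after Young's inequality. *)
pose eta := mu ^+ 2 / (2 * N ^+ 2 * tau + mu ^+ 2).
have den0 : 0 < 2 * N ^+ 2 * tau + mu ^+ 2.
  by rewrite addr_gt0 ?mulr_gt0 ?exprn_gt0.
have eta0 : 0 < eta by rewrite divr_gt0 ?exprn_gt0.
have eta1 : eta <= 1 by rewrite ler_pdivrMr// mul1r lerDr !mulr_ge0 ?sqr_ge0 ?ltW.
have etaN : N * (eta * tau * N / (2 * mu)) <= mu / 4.
  rewrite /eta.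
  have -> : N * (mu ^+ 2 / (2 * N ^+ 2 * tau + mu ^+ 2) * tau * N / (2 * mu)) =
     (mu / 4) * ((2 * N ^+ 2 * tau) / (2 * N ^+ 2 * tau + mu ^+ 2)).
    by field; rewrite !gt_eqF.
  rewrite ler_piMr ?divr_ge0 ?ltW// ltr_pdivrMr// mul1r ltrDl exprn_gt0//.
exists eta; first by rewrite eta0.
have etaW := ltW eta0.
clearbody eta.
move=> w.
have bound (i : 'I_n) : eta ^+ i * redot (w i 0) ((T *m w) i 0) <=
    - (mu / 2) * (eta ^+ i * sqmod (w i 0)) +
    \sum_(j < n) (eta * tau * N / (2 * mu)) * (eta ^+ j * sqmod (w j 0)).
  have ei : 0 < eta ^+ i by rewrite exprn_gt0.
  have eiW := ltW ei.
  rewrite mxE redot_sum (bigD1 i)//= redotM mulrDr.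
  have diag : eta ^+ i * (complex.Re (T i i) * sqmod (w i 0)) <=
      - mu * (eta ^+ i * sqmod (w i 0)).
    by rewrite mulrCA ler_wpM2r// mulr_ge0// ltW.
  have off : eta ^+ i * (\sum_(j | j != i) redot (w i 0) (T i j * w j 0)) <=
     (mu / 2) * (eta ^+ i * sqmod (w i 0)) +
     \sum_(j < n) (eta * tau * N / (2 * mu)) * (eta ^+ j * sqmod (w j 0)).
    have -> : (mu / 2) * (eta ^+ i * sqmod (w i 0)) =
        \sum_(j < n.+1) (mu / (2 * N)) * (eta ^+ i * sqmod (w i 0)).
      rewrite sumr_const card_ord -[RHS]mulr_natl Nn.
      by move: (eta ^+ i * _) => X; field; rewrite !gt_eqF.
    rewrite big_ord_recl -addrA -[leLHS]add0r lerD//.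
      by rewrite !mulr_ge0// invr_ge0 mulr_ge0.
    rewrite -big_split/= mulr_sumr big_mkcond/=; apply: ler_sum => j _.
    have g0 : 0 <= mu / (2 * N) * (eta ^+ i * sqmod (w i 0)) +
       eta * tau * N / (2 * mu) * (eta ^+ j * sqmod (w j 0)).
      by rewrite addr_ge0// !mulr_ge0// ?invr_ge0 ?mulr_ge0 ?exprn_ge0.
    case: ifP => // ji; have [ij|ij|/val_inj ij] := ltngtP i j; last first.
    - by rewrite ij eqxx in ji.
    - have k0 : 0 < mu / N by rewrite divr_gt0.
      rewrite (le_trans (ler_wpM2l (ltW ei) (redot_young _ _ _ k0)))//.
      rewrite mulrDr mulrDr lerD//.
        by rewrite le_eqVlt; apply/orP; left; apply/eqP;
          move: (eta ^+ i) (sqmod _) => X Y; field; rewrite gt_eqF.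
      have eij : eta ^+ i <= eta * eta ^+ j.
        rewrite -exprS -(subnK ij) exprD ler_piMl ?exprn_ge0//.
        by rewrite exprn_ile1.
      have -> : eta ^+ i * (2^-1 * (sqmod (T i j) * sqmod (w j 0) / (mu / N))) =
         (N / (2 * mu)) * (eta ^+ i * sqmod (T i j)) * sqmod (w j 0).
        by move: (eta ^+ i) (sqmod _) (sqmod _) => X Y Z; field; rewrite !gt_eqF.
      have -> : eta * tau * N / (2 * mu) * (eta ^+ j * sqmod (w j 0)) =
         (N / (2 * mu)) * ((eta * eta ^+ j) * tau) * sqmod (w j 0).
        by move: (eta ^+ j) (sqmod _) => X Y; field; rewrite !gt_eqF.
      rewrite ler_wpM2r// ler_wpM2l//; first by rewrite divr_ge0 ?mulr_ge0.
      by rewrite ler_pM.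
    - by rewrite trigT// mul0r /redot/= !mulr0 addr0 mulr0.
  by rewrite (le_trans (lerD diag off))// addrA lerD2r; lra.
rewrite (le_trans (ler_sum _ (fun i _ => bound i)))// big_split/= -mulr_sumr.
set S := \sum_(i < n) eta ^+ i * sqmod (w i 0).
have S0 : 0 <= S by rewrite sumr_ge0// => i _; rewrite mulr_ge0// exprn_ge0// ltW.
under [X in _ + X <= _]eq_bigr do rewrite -mulr_sumr -/S.
rewrite sumr_const card_ord -[X in _ + X <= _]mulr_natl mulrA.
have : n%:R * (eta * tau * N / (2 * mu)) <= mu / 4.
  rewrite (le_trans _ etaN)// ler_wpM2r//.
  by rewrite divr_ge0 ?mulr_ge0.
by move=> h; have := ler_wpM2r S0 h; lra.
Qed.

End lyapunov.

Section lyapunov_matrix.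
Context (R : realType).
Local Notation cplx := (map_mx (real_complex R)).

Let mulmx_cplxE n (P : 'M[R[i]]_n) (v : 'cV[R]_n) i :
  (P *m cplx v) i 0 = \sum_j P i j * (v j 0)%:C%C.
Proof. by rewrite mxE; apply: eq_bigr => j _; rewrite mxE. Qed.

Let redot_mulmx n (P : 'M[R[i]]_n) (v w : 'cV[R]_n) i :
  redot ((P *m cplx v) i 0) ((P *m cplx w) i 0) =
  \sum_j v j 0 * \sum_k redot (P i j) (P i k) * w k 0.
Proof.
have Re_sum (u : 'cV[R]_n) : complex.Re ((P *m cplx u) i 0) =
    \sum_j complex.Re (P i j) * u j 0.
  rewrite mulmx_cplxE; elim/big_rec2: _ => // j x [a b] _ <-.
  by case: (P i j) => c d /=; ring.
have Im_sum (u : 'cV[R]_n) : complex.Im ((P *m cplx u) i 0) =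
    \sum_j complex.Im (P i j) * u j 0.
  rewrite mulmx_cplxE; elim/big_rec2: _ => // j x [a b] _ <-.
  by case: (P i j) => c d /=; ring.
rewrite {1}/redot !Re_sum !Im_sum !mulr_suml -big_split/=.
apply: eq_bigr => j _; rewrite !mulr_sumr -big_split/=.
by apply: eq_bigr => k _; rewrite /redot; ring.
Qed.

Let sum_sqmod_unitary n (P : 'M[R[i]]_n) (v : 'cV[R]_n) : P \is unitarymx ->
  \sum_i sqmod ((P *m cplx v) i 0) = dot v v.
Proof.
move=> Pu.
have PP : P^t*%sesqui *m P = 1%:M.
  by rewrite -invmx_unitary// mulVmx// unitarymx_unit.
apply: (@complexI R); rewrite !rmorph_sum/=.
pose w := P *m cplx v.
transitivity ((w^t*%sesqui *m w) 0 0).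
  rewrite -/w; move: w => w; rewrite mxE; apply: eq_bigr => i _;
    rewrite !mxE mulrC.
  rewrite -[X in _ = _ * X]/((w i 0)^*%C); case: (w i 0) => a b.
  by apply/eqP; rewrite eq_complex/= /sqmod/=; apply/andP; split; apply/eqP; ring.
rewrite /w trmx_mul map_mxM -mulmxA (mulmxA _ P) PP mul1mx mxE.
apply: eq_bigr => i _; rewrite !mxE.
by apply/eqP; rewrite eq_complex/=; apply/andP; split; apply/eqP; ring.
Qed.

(** Bring M to triangular form by a unitary P and pull the weighted norm of
    [trig_lyapunov] back through P.  The weights lie between eta^n and 1 and P
    preserves the norm, which gives the lower bound. *)
Theorem lyapunov n (M : 'M[R]_n) : (0 < n)%N ->
  (forall l : R[i], eigenvalue (cplx M) l -> complex.Re l < 0) ->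
  exists (Q : 'M[R]_n) (c : R), [/\ 0 < c, Q^T = Q,
    forall v, c * dot v v <= dot v (Q *m v) &
    forall v, 2 * dot (Q *m v) (M *m v) <= - dot v v].
Proof.
move=> n0 eigM.
have [P Pu trigT] := Schur (cplx M) n0.
have Punit := unitarymx_unit Pu.
rewrite /similar_to in trigT; set T := conjmx P (cplx M) in trigT.
have PM : P *m cplx M = T *m P.
  by rewrite /T conjumx// mulmxKV.
have diagT i : complex.Re (T i i) < 0.
  apply: eigM; have : eigenvalue T (T i i).
    rewrite eigenvalue_root_char char_poly_trig//.
    by apply/rootP; rewrite (bigD1 i)//= hornerM hornerXsubC subrr mul0r.
  apply: eigenvalue_conjmx; last by rewrite row_free_unit.
  by rewrite stablemx_unit.
(* A positive lower bound for the numbers - Re (T i i). *)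
pose mu := (\sum_i (- complex.Re (T i i))^-1 + 1)^-1.
have inv_gt0 i : 0 < (- complex.Re (T i i))^-1 by rewrite invr_gt0 oppr_gt0.
have mu0 : 0 < mu.
  by rewrite invr_gt0 ltr_wpDl// sumr_ge0// => i _; rewrite ltW.
have Tmu i : complex.Re (T i i) <= - mu.
  rewrite lerNr -[leRHS]invrK lef_pV2 ?posrE ?inv_gt0 ?invr_gt0//; last first.
    by rewrite -invr_gt0.
  rewrite (bigD1 i)//= -addrA lerDl addr_ge0// sumr_ge0// => j _.
  by rewrite ltW.
have [eta /andP[eta0 eta1] lyapT] := trig_lyapunov trigT mu0 Tmu.
pose W : 'M[R]_n := \matrix_(j, k) \sum_(i < n) eta ^+ i * redot (P i j) (P i k).
have WE v w : dot v (W *m w) = \sum_(i < n) eta ^+ i *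
    redot ((P *m cplx v) i 0) ((P *m cplx w) i 0).
  rewrite /dot.
  transitivity (\sum_j \sum_k \sum_(i < n) eta ^+ i *
      (v j 0 * (redot (P i j) (P i k) * w k 0))).
    apply: eq_bigr => j _; rewrite mxE mulr_sumr; apply: eq_bigr => k _.
    by rewrite mxE mulr_suml mulr_sumr; apply: eq_bigr => i _; ring.
  under eq_bigr do rewrite exchange_big/=.
  rewrite exchange_big/=; apply: eq_bigr => i _; rewrite redot_mulmx mulr_sumr.
  by apply: eq_bigr => j _; rewrite !mulr_sumr.
have WT : W^T = W.
  by apply/matrixP => j k; rewrite !mxE; apply: eq_bigr => i _; rewrite /redot;
    ring.
have redotE u : redot u u = sqmod u by rewrite /redot /sqmod; ring.
have low v : eta ^+ n * dot v v <= dot v (W *m v).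
  rewrite WE -(sum_sqmod_unitary _ Pu) mulr_sumr; apply: ler_sum => i _.
  rewrite redotE ler_wpM2r ?addr_ge0 ?sqr_ge0//.
  have -> : eta ^+ n = eta ^+ (n - i) * eta ^+ i.
    by rewrite -exprD subnK// ltnW.
  by have etaW := ltW eta0; rewrite ler_piMl ?exprn_ge0 ?exprn_ile1.
(* The quadratic form decays at the rate (mu / 2) * eta ^+ n * |v|^2 at least;
   the factor k normalizes it to |v|^2. *)
pose k : R := 2 / (mu * eta ^+ n).
have en0 : 0 < eta ^+ n by rewrite exprn_gt0.
have k0 : 0 < k by rewrite divr_gt0 ?mulr_gt0.
exists (k *: W), (k * eta ^+ n); split.
- by rewrite mulr_gt0.
- by rewrite linearZ/= WT.
- by move=> v; rewrite -scalemxAl dotZr -mulrA ler_pM2l.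
- move=> v; rewrite -scalemxAl dotZl dot_mulmxl WT WE.
  have := lyapT (P *m cplx v).
  rewrite mulmxA -PM -mulmxA -map_mxM => h.
  have h2 := low v; rewrite WE in h2.
  have {}h2 : eta ^+ n * dot v v <=
    \sum_(i < n) eta ^+ i * sqmod ((P *m cplx v) i 0).
    by rewrite (le_trans h2)// le_eqVlt; apply/orP; left; apply/eqP;
      apply: eq_bigr => i _; rewrite redotE.
  have h3 : \sum_(i < n) eta ^+ i *
      redot ((P *m cplx v) i 0) ((P *m cplx (M *m v)) i 0) <=
      - (mu / 4) * (eta ^+ n * dot v v).
    rewrite (le_trans h)// !mulNr lerN2 ler_wpM2l// divr_ge0// ltW//.
  have := ler_wpM2l (ltW (mulr_gt0 (ltr0Sn R 1) k0)) h3.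
  rewrite mulrA => /le_trans; apply; rewrite le_eqVlt; apply/orP; left; apply/eqP.
  by rewrite /k; field; rewrite !gt_eqF.
Qed.

End lyapunov_matrix.

(** * Vector-valued functions *)

Section vector_functions.
Context (R : realType).
Implicit Types (a b c t s : R).
Local Notation mu := (@lebesgue_measure R).

Definition sqint k a b (f : R -> 'cV[R]_k) : Prop :=
  (forall i, measurable_fun `]a, b] (fun s => f s i 0)) /\
  integrable_oc a b (fun s => dot (f s) (f s)).

Lemma measurable_dot k (D : set R) (f g : R -> 'cV[R]_k) : measurable D ->
  (forall i, measurable_fun D (fun s => f s i 0)) ->
  (forall i, measurable_fun D (fun s => g s i 0)) ->
  measurable_fun D (fun s => dot (f s) (g s)).
Proof.
by move=> mD mf mg; apply: measurable_sum => i; exact: measurable_funM.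
Qed.

Lemma measurable_enorm k (D : set R) (f : R -> 'cV[R]_k) : measurable D ->
  (forall i, measurable_fun D (fun s => f s i 0)) ->
  measurable_fun D (fun s => enorm (f s)).
Proof.
move=> mD mf.
apply: (eq_measurable_fun (Num.sqrt \o (fun s => dot (f s) (f s)))).
  by move=> s _ /=; rewrite -sqr_enorm sqrtr_sqr ger0_norm ?enorm_ge0.
apply: measurableT_comp; last exact: measurable_dot.
by apply: continuous_measurable_fun; exact: sqrt_continuous.
Qed.

(** |f . g| <= |f|^2 + |g|^2. *)
Lemma integrable_oc_dot k a b (f g : R -> 'cV[R]_k) : sqint a b f ->
  sqint a b g ->
  integrable_oc a b (fun s => dot (f s) (g s)).
Proof.
move=> [mf If] [mg Ig]; apply: (integrable_oc_dom _ _ (integrable_ocD If Ig)).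
  exact: measurable_dot.
move=> s _ _; rewrite ler_norml; apply/andP; split.
  by have := dot_ge0 (f s + g s); rewrite dotDl !dotDr (dotC (g s) (f s));
    have := dot_ge0 (f s); have := dot_ge0 (g s); lra.
by have := dot_ge0 (f s - g s); rewrite dotBl !dotBr (dotC (g s) (f s));
  have := dot_ge0 (f s); have := dot_ge0 (g s); lra.
Qed.

Lemma sqint_dom k l a b (f : R -> 'cV[R]_k) (g : R -> 'cV[R]_l) (h : R -> R) :
  (forall i, measurable_fun `]a, b] (fun s => f s i 0)) ->
  (forall s, dot (f s) (f s) <= h s) -> integrable_oc a b h -> sqint a b f.
Proof.
move=> mf fh Ih; split => //; apply: integrable_oc_dom Ih;
  first exact: measurable_dot.
by move=> s _ _; rewrite ger0_norm ?dot_ge0.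
Qed.

Lemma sqintD k a b (f g : R -> 'cV[R]_k) : sqint a b f -> sqint a b g ->
  sqint a b (fun s => f s + g s).
Proof.
move=> [mf If] [mg Ig].
apply: (@sqint_dom _ k _ _ _ g _ _ _ (integrable_ocD (integrable_ocZ 2 If)
  (integrable_ocZ 2 Ig))).
  move=> i; apply: (eq_measurable_fun (fun s => f s i 0 + g s i 0)).
    by move=> s _; rewrite mxE.
  exact: measurable_funD.
by move=> s; exact: dotD_le.
Qed.

Lemma sqint_mulmx k l a b (M : 'M[R]_(l, k)) (f : R -> 'cV[R]_k) :
  sqint a b f -> sqint a b (fun s => M *m f s).
Proof.
move=> [mf If]; have [c c0 Mc] := dot_mulmx_le M.
apply: (@sqint_dom _ k _ _ _ f _ _ _ (integrable_ocZ c If)) => // i.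
apply: (eq_measurable_fun (fun s => \sum_j M i j * f s j 0)).
  by move=> s _; rewrite mxE.
by apply: measurable_sum => j; exact: measurable_funM.
Qed.

Lemma sqint_cst k a b (v : 'cV[R]_k) : sqint a b (fun=> v).
Proof. by split=> [i|]; [exact: measurable_cst|exact: integrable_oc_cst]. Qed.

Lemma sqintB k a b (f g : R -> 'cV[R]_k) : sqint a b f -> sqint a b g ->
  sqint a b (fun s => f s - g s).
Proof.
move=> If Ig; have := sqintD If (sqint_mulmx (- 1%:M) Ig).
by congr sqint; apply/funext => s; rewrite mulNmx mul1mx.
Qed.

Lemma eq_sqint k a b (f g : R -> 'cV[R]_k) :
  (forall s, a < s -> s <= b -> f s = g s) -> sqint a b f -> sqint a b g.
Proof.
move=> fg [mf If]; split=> [i|].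
  apply: eq_measurable_fun (mf i) => s; rewrite inE/= in_itv/= => /andP[as_ sb].
  by rewrite fg.
by apply: eq_integrable_oc If => s; rewrite in_itv/= => /andP[as_ sb]; rewrite fg.
Qed.

Lemma sqint_sub k a b c d (f : R -> 'cV[R]_k) : a <= c -> d <= b ->
  sqint a b f -> sqint c d f.
Proof.
move=> ac db [mf If]; split; last exact: integrable_oc_sub If.
move=> i; apply: measurable_funS (mf i) => //.
by apply: subset_itv; rewrite bnd_simp.
Qed.

Lemma sqint_coord k a b (f : R -> 'cV[R]_k) i : sqint a b f ->
  integrable_oc a b (fun s => f s i 0).
Proof.
move=> If; have := integrable_oc_dot (sqint_cst a b (delta_mx i 0)) If.
apply: eq_integrable_oc => s _; rewrite /dot (bigD1 i)//= big1 ?addr0.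
  by rewrite !mxE !eqxx mul1r.
by move=> j /negPf ji; rewrite mxE ji mul0r.
Qed.

Lemma sqint_cat k a b c (f : R -> 'cV[R]_k) : a <= b -> b <= c ->
  sqint a b f -> sqint b c f -> sqint a c f.
Proof.
move=> ab bc If Ig; split; last exact: integrable_oc_cat If.2 Ig.2.
by move=> i; apply: integrable_oc_meas; apply: (integrable_oc_cat ab bc);
  exact: sqint_coord.
Qed.

Lemma sqint_shift k a b d (f : R -> 'cV[R]_k) : sqint a b f ->
  sqint (a + d) (b + d) (fun s => f (s - d)).
Proof.
move=> If; split; last exact: (integrable_oc_shift d If.2).
by move=> i; apply: integrable_oc_meas;
  exact: (integrable_oc_shift d (sqint_coord i If)).
Qed.

Lemma sqint_integrable_enorm k a b (f : R -> 'cV[R]_k) : sqint a b f ->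
  integrable_oc a b (fun s => enorm (f s)).
Proof.
move=> If; apply: (integrable_oc_dom _ _ (integrable_ocD (integrable_oc_cst a b
  1) If.2)).
  exact: measurable_enorm If.1.
move=> s _ _; rewrite ger0_norm ?enorm_ge0// -sqr_enorm.
by have := sqr_ge0 (enorm (f s) - 2^-1); rewrite sqrrB; lra.
Qed.

Definition vprimitive k a b (y f : R -> 'cV[R]_k) : Prop :=
  forall i, primitive a b (fun t => y t i 0) (fun t => f t i 0).

Lemma vprimitive_sub k a b c d (y f : R -> 'cV[R]_k) : a <= c -> d <= b ->
  vprimitive a b y f -> vprimitive c d y f.
Proof. by move=> ac db yf i; exact: primitive_sub (yf i). Qed.

Lemma eq_vprimitive k a b (y1 y2 f1 f2 : R -> 'cV[R]_k) :
  (forall t, a <= t -> t <= b -> y1 t = y2 t) ->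
  (forall t, a < t -> t <= b -> f1 t = f2 t) ->
  vprimitive a b y1 f1 -> vprimitive a b y2 f2.
Proof.
move=> y12 f12 yf i.
by apply: eq_primitive (yf i) => t at_ tb; rewrite ?y12 ?f12.
Qed.

Lemma vprimitiveB k a b (y1 y2 f1 f2 : R -> 'cV[R]_k) :
  vprimitive a b y1 f1 -> vprimitive a b y2 f2 ->
  vprimitive a b (fun t => y1 t - y2 t) (fun t => f1 t - f2 t).
Proof.
move=> p1 p2 i.
by apply: eq_primitive (primitiveB (p1 i) (p2 i)) => t _ _; rewrite !mxE.
Qed.

Lemma vprimitive_cst k a b (v : 'cV[R]_k) : vprimitive a b (fun=> v) (fun=> 0).
Proof.
by move=> i; apply: eq_primitive (primitive_cst a b (v i 0)) => t _ _;
  rewrite ?mxE.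
Qed.

Lemma vprimitive_mulmx k l a b (M : 'M[R]_(l, k)) (y f : R -> 'cV[R]_k) :
  vprimitive a b y f ->
  vprimitive a b (fun t => M *m y t) (fun t => M *m f t).
Proof.
move=> yf i.
have := primitive_sum (index_enum 'I_k) (fun j => primitiveZ (M i j) (yf j)).
by apply: eq_primitive => t _ _; rewrite mxE.
Qed.

Lemma vprimitive_shift k a b d (y f : R -> 'cV[R]_k) : vprimitive a b y f ->
  vprimitive (a + d) (b + d) (fun t => y (t - d)) (fun t => f (t - d)).
Proof. by move=> yf i; exact: (primitive_shift d (yf i)). Qed.

Lemma vprimitive_cat k a b c (y f : R -> 'cV[R]_k) : a <= b -> b <= c ->
  vprimitive a b y f -> vprimitive b c y f -> vprimitive a c y f.
Proof. by move=> ab bc p1 p2 i; exact: primitive_cat (p1 i) (p2 i). Qed.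

Lemma primitive_dot k a b (y w f g : R -> 'cV[R]_k) :
  vprimitive a b y f -> vprimitive a b w g ->
  primitive a b (fun t => dot (y t) (w t))
    (fun t => dot (f t) (w t) + dot (y t) (g t)).
Proof.
move=> yf wg.
have := primitive_sum (index_enum 'I_k) (fun i => primitiveM (yf i) (wg i)).
by apply: eq_primitive => t _ _ //; rewrite /dot big_split.
Qed.

Lemma primitive_dotl k a b v (y f : R -> 'cV[R]_k) : vprimitive a b y f ->
  primitive a b (fun t => dot v (y t)) (fun t => dot v (f t)).
Proof.
move=> yf; have := primitive_dot (vprimitive_cst a b v) yf.
by apply: eq_primitive => t _ _ //; rewrite dotC dot0r add0r.
Qed.

Lemma vprimitive_sqint k a b (y f : R -> 'cV[R]_k) : vprimitive a b y f ->
  sqint a b y.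
Proof.
move=> yf; split=> [i|]; first exact: primitive_measurable (yf i).
exact: integrable_oc_primitive (primitive_dot yf yf).
Qed.

End vector_functions.

(** * The linear system and detectability *)

Section linear_control_system.
Context (R : realType) (n m : nat) (A : 'M[R]_n) (B : 'M[R]_(n, m)).
Implicit Types (a b c t s : R) (u v : R -> 'cV[R]_m) (y e : R -> 'cV[R]_n).

Definition state_eq a b u y : Prop :=
  vprimitive a b y (fun s => A *m y s + B *m u s).

Lemma state_eqB a b u1 y1 u2 y2 : state_eq a b u1 y1 -> state_eq a b u2 y2 ->
  state_eq a b (fun s => u1 s - u2 s) (fun s => y1 s - y2 s).
Proof.
move=> s1 s2; apply: eq_vprimitive (vprimitiveB s1 s2) => // t _ _.
by rewrite !mulmxBr opprD addrACA.
Qed.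

Lemma state_eq_cst a b (u : 'cV[R]_m) (y : 'cV[R]_n) : A *m y + B *m u = 0 ->
  state_eq a b (fun=> u) (fun=> y).
Proof.
by move=> E; apply: eq_vprimitive (vprimitive_cst a b y) => t _ _; rewrite ?E.
Qed.

(** With M = A + L C stable, the state equation reads
    e' = M e + (B v - L C e).  For the Lyapunov matrix Q of M, the derivative of
    e . Q e is at most - |e|^2 / 2 + k1 (|v|^2 + |C e|^2); integrate it. *)
Theorem detectable_estimate (C : 'M[R]_n) : (0 < n)%N -> detectable A C ->
  exists2 k : R, 0 <= k & forall a b v e, a <= b -> sqint a b v ->
    state_eq a b v e ->
    dot (e b) (e b) + int_oc a b (fun s => dot (e s) (e s)) <=
    k * (dot (e a) (e a) +
         int_oc a b (fun s => dot (v s) (v s) + dot (C *m e s) (C *m e s))).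
Proof.
move=> n0 [L /(lyapunov n0)[Q [c [c0 QT Qlow Qdec]]]].
have [q q0 Qq] := dot_mulmx_le Q.
have [bB b0 Bb] := dot_mulmx_le B.
have [l l0 Ll] := dot_mulmx_le L.
pose k1 := 4 * (q + 1) * (bB + l).
pose mn := Num.min c 2^-1.
have mn0 : 0 < mn by rewrite lt_min c0 invr_gt0 ltr0n.
have k10 : 0 <= k1 by rewrite !mulr_ge0 ?addr_ge0.
exists ((1 + q + k1) / mn).
  by rewrite divr_ge0 ?addr_ge0// ltW.
move=> a b v e ab Iv ev.
have Ie := vprimitive_sqint ev; have ICe := sqint_mulmx C Ie.
have pQ := primitive_dot ev (vprimitive_mulmx Q ev).
have IJ : integrable_oc a b (fun s =>
  dot (v s) (v s) + dot (C *m e s) (C *m e s)).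
  by apply: integrable_ocD; [exact: Iv.2|exact: ICe.2].
have Edec : int_oc a b (fun s => dot (A *m e s + B *m v s) (Q *m e s) +
     dot (e s) (Q *m (A *m e s + B *m v s))) <=
   int_oc a b (fun s => - 2^-1 * dot (e s) (e s) +
     k1 * (dot (v s) (v s) + dot (C *m e s) (C *m e s))).
  apply: le_int_oc; [exact: pQ.1| |move=> s _ _].
    by apply: integrable_ocD; apply: integrable_ocZ => //; exact: Ie.2.
  move: (e s) (v s) => {pQ Ie ICe IJ ev Iv}e {}v.
  rewrite [X in X + _]dotC [X in _ + X]dot_mulmxr QT -mulr2n -mulr_natl.
  (* Young's inequality spends half of the decay of e . Q e on the forcing f. *)
  pose f := B *m v - L *m (C *m e).
  have -> : A *m e + B *m v = (A + L *m C) *m e + f.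
    by rewrite /f mulmxDl -mulmxA -addrA; congr (_ + _); rewrite addrC subrK.
  rewrite dotDr mulrDr.
  have h1 := Qdec e.
  have g0 : 0 < (2 * (q + 1))^-1 by rewrite invr_gt0 mulr_gt0// ltr_wpDl.
  have h2 := dot_young (Q *m e) f g0; rewrite invrK in h2.
  have h3 : (2 * (q + 1))^-1 * dot (Q *m e) (Q *m e) <= 2^-1 * dot e e.
    rewrite invfM -mulrA ler_wpM2l// ler_pdivrMl ?ltr_wpDl//.
    by rewrite (le_trans (Qq e))// ler_wpM2r ?dot_ge0// lerDl.
  have h4 : dot f f <= 2 * (bB * dot v v) + 2 * (l * dot (C *m e) (C *m e)).
    have := dotD_le (B *m v) (- (L *m (C *m e))).
    rewrite dotNl dotNr opprK -/f => /le_trans; apply.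
    by rewrite lerD// ler_pM2l.
  have h5 : dot f f * (2 * (q + 1)) <= k1 * (dot v v + dot (C *m e) (C *m e)).
    have q1 : 0 <= 2 * (q + 1) by rewrite mulr_ge0// addr_ge0.
    rewrite (le_trans (ler_wpM2r q1 h4))//.
    have -> : k1 = (bB + l) * 2 * (2 * (q + 1)) by rewrite /k1; ring.
    rewrite -!mulrA [_ * (2 * (q + 1))]mulrC.
    have vv := dot_ge0 v; have cc := dot_ge0 (C *m e).
    rewrite [X in _ <= X](_ : _ = 2 * (q + 1) * (2 * ((bB + l) * (dot v v +
      dot (C *m e) (C *m e))))); last by ring.
    rewrite ler_wpM2l// -mulrDr ler_pM2l//.
    rewrite !mulrDl !mulrDr; have := mulr_ge0 b0 cc; have := mulr_ge0 l0 vv; lra.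
  by move: h1 h2 h3 h5; move: (dot _ _) (dot _ _) (dot _ _) => X1 X2 X3; lra.
rewrite -(primitive_diff pQ (lexx a) ab (lexx b)) in Edec.
rewrite int_ocD ?int_ocZ// in Edec; last 3 first.
- exact: Ie.2.
- by apply: integrable_ocZ; exact: Ie.2.
- exact: integrable_ocZ.
set X := int_oc a b (fun s => dot (e s) (e s)) in Edec *.
set Y := int_oc a b _ in Edec *.
have X0 : 0 <= X by apply: int_oc_ge0 => s _ _; exact: dot_ge0.
have Y0 : 0 <= Y by apply: int_oc_ge0 => s _ _; rewrite addr_ge0 ?dot_ge0.
have low := Qlow (e b).
have up : dot (e a) (Q *m e a) <= (1 + q) * dot (e a) (e a).
  have := dot_young (e a) (Q *m e a) (@ltr01 R); rewrite mul1r divr1.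
  have := Qq (e a); have := dot_ge0 (e a); have := mulr_ge0 q0 (dot_ge0 (e a));
    lra.
rewrite mulrAC ler_pdivlMr// mulrC mulrDr.
have m1 : mn * dot (e b) (e b) <= c * dot (e b) (e b).
  by rewrite ler_wpM2r ?dot_ge0// ge_min lexx.
have m2 : mn * X <= 2^-1 * X by rewrite ler_wpM2r// ge_min lexx orbT.
have k1a := mulr_ge0 k10 (dot_ge0 (e a)).
have qY := mulr_ge0 q0 Y0.
rewrite !mulrDl !mulrDr !mul1r; move: Edec; lra.
Qed.

End linear_control_system.

(** * Steady optimality and dissipation *)

Section dissipativity.
Context (R : realType) (n m : nat).
Context (A : 'M[R]_n) (B : 'M[R]_(n, m)) (C : 'M[R]_n) (z : 'cV[R]_n).
Context (U : set 'cV[R]_m).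
Implicit Types (a b c t s : R) (u v : R -> 'cV[R]_m) (y e : R -> 'cV[R]_n).
Local Notation mu := (@lebesgue_measure R).
Local Notation J := (steady_cost C z).

Lemma steady_costE (u : 'cV[R]_m) (y : 'cV[R]_n) :
  J u y = 2^-1 * (dot u u + dot (C *m y - z) (C *m y - z)).
Proof. by rewrite /steady_cost !sqr_enorm. Qed.

Lemma steady_cost_expand (u0 u : 'cV[R]_m) (y0 y : 'cV[R]_n) :
  J u y - J u0 y0 =
  dot u0 (u - u0) + dot (C *m y0 - z) (C *m (y - y0)) +
  2^-1 * (dot (u - u0) (u - u0) + dot (C *m (y - y0)) (C *m (y - y0))).
Proof.
rewrite !steady_costE.
have -> : C *m y - z = (C *m y0 - z) + C *m (y - y0).
  by rewrite mulmxBr [RHS]addrC addrA subrK.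
have {1 2}-> : u = u0 + (u - u0) by rewrite [RHS]addrC subrK.
move: (C *m y0 - z) (C *m (y - y0)) (u - u0) => p q w.
rewrite !dotDl !dotDr (dotC q p) (dotC w u0).
by field.
Qed.

Lemma integrable_oc_steady_cost a b u y : sqint a b u -> sqint a b y ->
  integrable_oc a b (fun s => J (u s) (y s)).
Proof.
move=> Iu Iy; have ICy := sqintB (sqint_mulmx C Iy) (sqint_cst a b z).
have := integrable_ocZ 2^-1 (integrable_ocD Iu.2 ICy.2).
by apply: eq_integrable_oc => s _; rewrite steady_costE.
Qed.

Definition feasible a b u : Prop :=
  sqint a b u /\ {ae mu, forall t : R, t \in `]a, b[ -> U (u t)}.

(** Otherwise the linear term wins for small h. *)
Let first_order (p q : R) : (forall h : R, 0 < h -> h < 1 ->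
  0 <= h * p + h ^+ 2 * q) ->
  0 <= p.
Proof.
move=> H; rewrite leNgt; apply/negP => p0.
pose d := 1 - p + `|q|.
have d0 : 0 < d by rewrite /d ltr_wpDr// subr_gt0 (lt_trans p0).
pose h := - p / (2 * d).
have h0 : 0 < h by rewrite divr_gt0 ?oppr_gt0 ?mulr_gt0.
have h1 : h < 1.
  rewrite ltr_pdivrMr ?mulr_gt0// mul1r /d; have := normr_ge0 q; lra.
have := H h h0 h1; rewrite expr2 -mulrA -mulrDr pmulr_rge0//.
have : h * q <= - p / 2.
  rewrite (le_trans (ler_norm _))// normrM (gtr0_norm h0) /h.
  have -> : - p / (2 * d) * `|q| = (- p / 2) * (`|q| / d) by field;
    rewrite gt_eqF.
  rewrite ler_piMr ?divr_ge0 ?oppr_ge0 ?ltW// ltr_pdivrMr// mul1r /d; lra.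
by lra.
Qed.

Lemma convex_segment (v w : 'cV[R]_m) h : convex_set U -> U v -> U w ->
  0 < h -> h < 1 ->
  U (v + h *: (w - v)).
Proof.
move=> cU Uv Uw h0 h1.
have := cU w v (Itv01 (ltW h0) (ltW h1)); rewrite !inE => /(_ Uw Uv).
rewrite /conv/=.
have -> : h *: (w : 'cV[R]_m) + (1 - h) *: (v : 'cV[R]_m) = v + h *: (w - v).
  by rewrite scalerBl scale1r scalerBr addrC -addrA [- _ + _]addrC.
by [].
Qed.

(** Moving from ubar towards w in U moves the steady state by
    d = - A^-1 B (w - ubar), and the first variation of the steady cost along
    this move is nonnegative.  The multiplier p eliminates d from it, because
    (C ybar - z) . C d = - A^T p . d = p . B (w - ubar). *)
Theorem steady_variational (ubar : 'cV[R]_m) (ybar : 'cV[R]_n) :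
  convex_set U -> A \in unitmx -> steady_minimizer A B C z U ubar ybar ->
  exists p : 'cV[R]_n, A^T *m p = - (C^T *m (C *m ybar - z)) /\
    forall w : 'cV[R]_m, U w -> 0 <= dot ubar (w - ubar) +
      dot p (B *m (w - ubar)).
Proof.
move=> cU Au [[/= Ubar Ebar] Jmin].
pose q := C^T *m (C *m ybar - z).
exists (- (invmx A^T *m q)); split.
  by rewrite mulmxN mulKVmx ?unitmx_tr.
move=> v Uv; pose d := - (invmx A *m (B *m (v - ubar))).
have Ad : A *m d + B *m (v - ubar) = 0 by rewrite mulmxN mulKVmx// addrC subrr.
have -> : dot (- (invmx A^T *m q)) (B *m (v - ubar)) =
  dot (C *m ybar - z) (C *m d).
  by rewrite dotNl -trmx_inv -dot_mulmxr [RHS]dot_mulmxr -/q /d dotNr.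
apply: (@first_order _ (2^-1 * (dot (v - ubar) (v - ubar) +
  dot (C *m d) (C *m d)))).
move=> h h0 h1.
have Jh : J ubar ybar <= J (ubar + h *: (v - ubar)) (ybar + h *: d).
  apply: Jmin; split; first exact: convex_segment.
  rewrite /= !mulmxDr -!scalemxAr addrACA -scalerDr Ebar Ad.
  by rewrite scaler0 addr0.
move: Jh; rewrite -subr_ge0 steady_cost_expand !(addrC ubar) !(addrC ybar) !addrK.
rewrite -scalemxAr !dotZl !dotZr.
by set X := dot _ _; set Y := dot _ (C *m _); set Z := dot _ _;
  set W := dot _ _; lra.
Qed.

Lemma ae_feasible_ge0 a b u (P : R -> R) : feasible a b u ->
  (forall s, U (u s) -> 0 <= P s) -> integrable_oc a b P -> 0 <= int_oc a b P.
Proof.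
move=> [_ aeU] UP IP; apply: ae_int_oc_ge0 => //.
by apply: ae_imply aeU => s /= H sab; apply/UP/H.
Qed.

(** Expand the running cost around (ubar, ybar).  Its linear part
    ubar . v + (C ybar - z) . C e equals
    (ubar . v + p . B v) - p . (A e + B v): the first term is nonnegative on U,
    and the second is minus the derivative of p . y. *)
Theorem dissipation (ubar : 'cV[R]_m) (ybar : 'cV[R]_n) :
  convex_set U -> A \in unitmx -> steady_minimizer A B C z U ubar ybar ->
  exists p : 'cV[R]_n, forall a b u y, a <= b -> feasible a b u ->
    state_eq A B a b u y ->
    2^-1 * int_oc a b (fun s => dot (u s - ubar) (u s - ubar) +
                    dot (C *m (y s - ybar)) (C *m (y s - ybar))) -
    dot p (y b - y a) + J ubar ybar * (b - a) <=
    int_oc a b (fun s => J (u s) (y s)).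
Proof.
move=> cU Au Jmin; have [p [Ap varU]] := steady_variational cU Au Jmin.
have [[/= _ Ebar] _] := Jmin.
exists p => a b u y ab fu yu; have Iu := fu.1.
have Iy := vprimitive_sqint yu.
have Iv := sqintB Iu (sqint_cst a b ubar).
have Ie := sqintB Iy (sqint_cst a b ybar).
have ICe := sqint_mulmx C Ie.
have py := primitive_dotl p yu.
have I1 := integrable_ocZ 2^-1 (integrable_ocD Iv.2 ICe.2).
have I2 := integrable_ocB I1 py.1.
have I3 := integrable_ocD I2 (integrable_oc_cst a b (J ubar ybar)).
have I4 := integrable_oc_steady_cost Iu Iy.
have -> : dot p (y b - y a) = dot p (y b) - dot p (y a) by rewrite dotBr.
rewrite (primitive_diff py (lexx a) ab (lexx b)) -(int_oc_cst _ ab) -int_ocZ;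
  last first.
  by apply: integrable_ocD; [exact: Iv.2|exact: ICe.2].
rewrite -int_ocB//; last exact: py.1.
rewrite -int_ocD//; last exact: integrable_oc_cst.
rewrite -subr_ge0 -int_ocB//.
apply: (ae_feasible_ge0 fu); last exact: integrable_ocB.
move=> s /varU; have := steady_cost_expand ubar (u s) ybar (y s).
have -> : A *m y s + B *m u s = A *m (y s - ybar) + B *m (u s - ubar).
  by rewrite !mulmxBr addrACA -opprD Ebar subr0.
rewrite [dot p (_ + _)]dotDr (dot_mulmxr A) Ap dotNl -dot_mulmxr.
lra.
Qed.

(** Let (w, r) be the difference of the two pairs and (v, e) the deviation of the
    reference pair from the steady one.  The products ubar . w and
    (C ybar - z) . C r are bounded through the L1 norms of w and r.  For v . w and
    C e . C r, Young's inequality with weight d leaves d (|v|^2 + |e|^2) and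
    (|w|^2 + |r|^2) / d, whose integrals are both of order d. *)
Theorem tracking_cost (ubar : 'cV[R]_m) (ybar : 'cV[R]_n) :
  exists2 k : R, 0 <= k & forall (K d : R) a b u1 y1 u y, 0 <= K -> 0 < d ->
    a <= b ->
    sqint a b u1 -> sqint a b y1 -> sqint a b u -> sqint a b y ->
    int_oc a b (fun s => dot (u1 s - ubar) (u1 s - ubar) +
                      dot (y1 s - ybar) (y1 s - ybar)) <= K ->
    int_oc a b (fun s => enorm (u s - u1 s)) <= d ->
    int_oc a b (fun s => dot (u s - u1 s) (u s - u1 s)) <= d ^+ 2 ->
    int_oc a b (fun s => enorm (y s - y1 s)) <= d ->
    int_oc a b (fun s => dot (y s - y1 s) (y s - y1 s)) <= d ^+ 2 ->
    int_oc a b (fun s => J (u s) (y s)) - int_oc a b (fun s => J (u1 s) (y1 s)) <=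
    k * (1 + K + d) * d.
Proof.
have [c c0 Cc] := dot_mulmx_le C.
pose q := C^T *m (C *m ybar - z).
exists (enorm ubar + enorm q + 1 + c).
  by rewrite !addr_ge0// enorm_ge0.
move=> K d a b u1 y1 u y K0 d0 ab Iu1 Iy1 Iu Iy H1 H2 H3 H4 H5.
have Iw := sqintB Iu Iu1; have Ir := sqintB Iy Iy1.
have Iv := sqintB Iu1 (sqint_cst a b ubar).
have Ie := sqintB Iy1 (sqint_cst a b ybar).
have Ive := integrable_ocD Iv.2 Ie.2.
have d1 : 0 < d^-1 by rewrite invr_gt0.
have Iew := sqint_integrable_enorm Iw; have Ier := sqint_integrable_enorm Ir.
have J1 := integrable_ocZ (enorm ubar) Iew.
have J2 := integrable_ocZ (enorm q) Ier.
have J3 := integrable_ocZ (d / 2 * (1 + c)) Ive.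
have J4 := integrable_ocZ (2^-1 * (1 + d^-1)) Iw.2.
have J5 := integrable_ocZ (c / 2 * (1 + d^-1)) Ir.2.
have J12 := integrable_ocD J1 J2; have J123 := integrable_ocD J12 J3.
have J1234 := integrable_ocD J123 J4; have J12345 := integrable_ocD J1234 J5.
have Ic := integrable_oc_steady_cost Iu Iy;
  have Ic1 := integrable_oc_steady_cost Iu1 Iy1.
rewrite -int_ocB//; apply: (le_trans (le_int_oc (integrable_ocB Ic Ic1) J12345
  _)).
  move=> s _ _; rewrite steady_cost_expand.
  move: (u s - u1 s) (y s - y1 s) => w r.
  have u1E : u1 s = ubar + (u1 s - ubar) by rewrite [RHS]addrC subrK.
  have y1E : C *m y1 s - z = (C *m ybar - z) + C *m (y1 s - ybar).
    by rewrite mulmxBr [RHS]addrC addrA subrK.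
  rewrite [X in dot X w]u1E y1E.
  move: (u1 s - ubar) (y1 s - ybar) => v e.
  rewrite [dot (ubar + _) _]dotDl [dot (_ - z + _) _]dotDl.
  rewrite [dot (C *m ybar - z) _]dot_mulmxr -/q.
  have h1 := le_trans (ler_norm _) (dot_cauchy ubar w).
  have h2 := le_trans (ler_norm _) (dot_cauchy q r).
  have h3 := dot_young v w d0.
  have h4 := dot_young (C *m e) (C *m r) d0.
  have h5 : d * dot (C *m e) (C *m e) <= d * (c * dot e e).
    by rewrite ler_pM2l.
  have h6 : dot (C *m r) (C *m r) / d <= c * dot r r / d.
    by rewrite ler_pM2r.
  have h7 := Cc r.
  have h8 := mulr_ge0 (mulr_ge0 (ltW d0) c0) (dot_ge0 v).
  have h9 := mulr_ge0 (ltW d0) (dot_ge0 e).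
  move: h1 h2 h3 h4 h5 h6 h7 h8 h9; lra.
rewrite int_ocD// int_ocD// int_ocD// int_ocD// !int_ocZ//;
  [|exact: Ir.2|exact: Iw.2].
have eu := enorm_ge0 ubar; have eq_ := enorm_ge0 q.
have b1 := ler_wpM2l eu H2; have b2 := ler_wpM2l eq_ H4.
have b3 : d / 2 * (1 + c) * int_oc a b (fun s => dot (u1 s - ubar) (u1 s - ubar) +
  dot (y1 s - ybar) (y1 s - ybar)) <= d / 2 * (1 + c) * K.
  by rewrite ler_wpM2l// !mulr_ge0 ?addr_ge0// ltW.
have b4 : 2^-1 * (1 + d^-1) * int_oc a b (fun s => dot (u s - u1 s) (u s - u1 s))
   <= 2^-1 * (d ^+ 2 + d).
  have <- : 2^-1 * (1 + d^-1) * d ^+ 2 = 2^-1 * (d ^+ 2 + d).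
    by field; rewrite gt_eqF.
  by rewrite ler_wpM2l// mulr_ge0// addr_ge0// ltW.
have b5 : c / 2 * (1 + d^-1) * int_oc a b (fun s => dot (y s - y1 s) (y s - y1 s))
   <= c / 2 * (d ^+ 2 + d).
  have <- : c / 2 * (1 + d^-1) * d ^+ 2 = c / 2 * (d ^+ 2 + d).
    by field; rewrite gt_eqF.
  by rewrite ler_wpM2l// !mulr_ge0// addr_ge0// ltW.
rewrite (le_trans (lerD (lerD (lerD (lerD b1 b2) b3) b4) b5))//.
have t1 : 0 <= (enorm ubar + enorm q) * (K + d) * d.
  by rewrite !mulr_ge0 ?addr_ge0// ltW.
have t2 : 0 <= (1 + c) * K * d by rewrite !mulr_ge0 ?addr_ge0// ltW.
have t3 : 0 <= (1 + c) * d * d by rewrite !mulr_ge0 ?addr_ge0// ltW.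
have t4 : 0 <= (1 + c) * d by rewrite !mulr_ge0 ?addr_ge0// ltW.
by move: t1 t2 t3 t4; rewrite expr2; lra.
Qed.

End dissipativity.

(** * From extended-real functionals to real integrals *)

Section functionals.
Context (R : realType) (n m : nat).
Context (A : 'M[R]_n) (B : 'M[R]_(n, m)) (C : 'M[R]_n) (z : 'cV[R]_n).
Context (U : set 'cV[R]_m).
Implicit Types (a b c t s T : R) (u v : R -> 'cV[R]_m) (y e : R -> 'cV[R]_n).
Local Notation mu := (@lebesgue_measure R).
Local Notation J := (steady_cost C z).

Lemma Lnorm_on1 k (D : set R) (f : R -> 'cV[R]_k) : measurable D ->
  (Lnorm_on 1%:E D f = \int[mu]_(t in D) (enorm (f t))%:E)%E.
Proof.
move=> mD; rewrite /Lnorm_on Lnorm1 [RHS]integral_mkcond.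
apply: eq_integral => t _; rewrite !patchE; case: ifP => _; last by rewrite abse0.
by rewrite gee0_abs// lee_fin enorm_ge0.
Qed.

Lemma Lnorm_on2 k (D : set R) (f : R -> 'cV[R]_k) : measurable D ->
  (Lnorm_on 2%:E D f =
   (\int[mu]_(t in D) (dot (f t) (f t))%:E) `^ (2^-1)%R)%E.
Proof.
move=> mD; rewrite /Lnorm_on unlock; congr (_ `^ _)%E.
rewrite [RHS]integral_mkcond; apply: eq_integral => t _; rewrite !patchE.
case: ifP => _; last by rewrite abse0 poweR0r.
by rewrite gee0_abs ?lee_fin ?enorm_ge0// poweR_EFin powR_mulrn ?enorm_ge0//
  sqr_enorm.
Qed.

Lemma int_oc_le_of_integral (D : set R) a b (f : R -> R) (k : R) : measurable D ->
  `]a, b] `<=` D -> measurable_fun D f -> (forall s, 0 <= f s) ->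
  (\int[mu]_(s in D) (f s)%:E <= k%:E)%E ->
    integrable_oc a b f /\ int_oc a b f <= k.
Proof.
move=> mD abD mf f0 fk.
have sub : (\int[mu]_(s in `]a, b]) (f s)%:E <= k%:E)%E.
  apply: le_trans fk; apply: ge0_subset_integral => //.
    exact/measurable_EFinP.
  by move=> s _; rewrite lee_fin.
have If : integrable_oc a b f.
  apply/integrableP; split.
    by apply/measurable_EFinP; apply: measurable_funS mf.
  under eq_integral do rewrite /= ger0_norm//.
  by apply: le_lt_trans sub _; rewrite ltry.
split => //; rewrite -lee_fin int_ocE /Rintegral fineK//.
exact: integrable_fin_num.
Qed.

Lemma sqr_le_poweR_half (X : \bar R) (k : R) : (0 <= X)%E -> 0 <= k ->
  (X `^ (2^-1)%R <= k%:E)%E -> (X <= (k ^+ 2)%:E)%E.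
Proof.
move=> X0 k0; case: X X0 => [r| |]//; last first.
  by rewrite /= gt_eqF ?invr_gt0// => _; rewrite leye_eq.
rewrite !lee_fin => r0; rewrite powR12_sqrt// => rk.
by rewrite -[leLHS]sqr_sqrtr// ler_sqr// nnegrE sqrtr_ge0.
Qed.

Lemma L1L2_bounds k a b (f : R -> 'cV[R]_k) (K : R) : 0 <= a -> 0 <= K ->
  (forall i, measurable_fun (`]0, +oo[ : set R) (fun s => f s i 0)) ->
  (norm_L1L2 f <= K%:E)%E ->
  [/\ sqint a b f, int_oc a b (fun s => enorm (f s)) <= K &
      int_oc a b (fun s => dot (f s) (f s)) <= K ^+ 2].
Proof.
move=> a0 K0 mf; rewrite /norm_L1L2 Lnorm_on1// Lnorm_on2// => fK.
have sub : (`]a, b] : set R) `<=` `]0, +oo[.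
  by apply: subset_itv; rewrite bnd_simp.
have i1 : (\int[mu]_(t in `]0%R, +oo[) (enorm (f t))%:E <= K%:E)%E.
  by apply: le_trans fK; rewrite leeDl// poweR_ge0.
have i2 : (\int[mu]_(t in `]0%R, +oo[) (dot (f t) (f t))%:E <= (K ^+ 2)%:E)%E.
  apply: sqr_le_poweR_half => //.
    by apply: integral_ge0 => t _; rewrite lee_fin dot_ge0.
  apply: le_trans fK; rewrite leeDr//.
  by apply: integral_ge0 => t _; rewrite lee_fin enorm_ge0.
have [_ h1] := int_oc_le_of_integral (measurable_itv _) sub
  (measurable_enorm (measurable_itv _) mf) (fun s => enorm_ge0 (f s)) i1.
have [h2 h3] := int_oc_le_of_integral (measurable_itv _) sub
  (measurable_dot (measurable_itv _) mf mf) (fun s => dot_ge0 (f s)) i2.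
split => //; split => // i.
by apply: measurable_funS (mf i).
Qed.

Lemma admissibleP T u : admissible_control U T u <-> feasible U 0 T u.
Proof.
split=> -[[meas_u Iu] aeU]; split=> //; split.
- by move=> i; apply/measurable_fun_itv_bndo_bndcP.
- apply/integrable_oc_oo/integrableP; split.
    by apply/measurable_EFinP; exact: measurable_dot.
  move: Iu; rewrite Lnorm_on2// => /lty_poweRy;
    rewrite invr_eq0 pnatr_eq0 => /(_ isT).
  by under [in X in _ -> X]eq_integral do rewrite /= ger0_norm ?dot_ge0//.
- by move=> i; apply/measurable_fun_itv_bndo_bndcP.
- by rewrite Lnorm_on2// int_oc_EFin// poweR_EFin ltry.
Qed.

Lemma trajectoryP T x u y : 0 <= T ->
  trajectory A B T x u y <-> state_eq A B 0 T u y /\ y 0 = x.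
Proof.
move=> T0; split=> [tr|[st y0] i].
  have y0 : y 0 = x.
    apply/matrixP => i j; rewrite ord1; have [_ ->] := tr i; last first.
      by rewrite in_itv/= lexx.
    by rewrite set_itv1 Rintegral_set1 addr0.
  split => // i; have [Ii yi] := tr i; split; first exact/integrable_oc_cc.
  move=> t t0 tT; rewrite yi ?in_itv/= ?t0// -y0 int_oc_cc//.
  by apply: integrable_oc_sub (lexx _) tT _; exact/integrable_oc_cc.
have [Ii yi] := st i; split; first exact/integrable_oc_cc.
move=> t; rewrite in_itv/= => /andP[t0 tT]; rewrite yi// y0 int_oc_cc//.
by apply: integrable_oc_sub (lexx _) tT _.
Qed.

Lemma costE g T u y : 0 <= T -> feasible U 0 T u -> state_eq A B 0 T u y ->
  cost C z g T u y = (int_oc 0 T (fun s => J (u s) (y s)) + g (y T))%:E.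
Proof.
move=> T0 [Iu _] st; have Iy := vprimitive_sqint st.
have ICy := sqintB (sqint_mulmx C Iy) (sqint_cst 0 T z).
have I2 : integrable_oc 0 T (fun s =>
  enorm (u s) ^+ 2 + enorm (C *m y s - z) ^+ 2).
  by have := integrable_ocD Iu.2 ICy.2; apply: eq_integrable_oc => s _;
    rewrite !sqr_enorm.
by rewrite /cost int_oc_EFin// -EFinM -EFinD int_ocZ.
Qed.

Lemma optimalP g T x u y : 0 <= T -> optimal A B C z U g T x u y ->
  [/\ feasible U 0 T u, state_eq A B 0 T u y, y 0 = x &
      forall v w, feasible U 0 T v -> state_eq A B 0 T v w -> w 0 = x ->
        int_oc 0 T (fun s => J (u s) (y s)) + g (y T) <=
        int_oc 0 T (fun s => J (v s) (w s)) + g (w T)].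
Proof.
move=> T0 [/admissibleP fu /(trajectoryP _ _ _ T0)[st y0] opt]; split => //.
move=> v w fv sw w0.
have := opt v w; rewrite (costE _ T0 fu st) (costE _ T0 fv sw) lee_fin; apply.
  exact/admissibleP.
exact/trajectoryP.
Qed.

End functionals.

(** * Continuity of the terminal cost *)

Section terminal_cost.
Context (R : realType) (n : nat) (g : 'cV[R]_n -> R).
Context (g_loclip : [locally [lipschitz g v | v in setT]]).

(** The neighbourhoods in the definition of local Lipschitz continuity are those
    of pairs of points.  At the diagonal pair (w, w) they let both arguments
    move. *)
Lemma local_oscillation (w : 'cV[R]_n) (eta : R) : 0 < eta ->
  exists2 r : R, 0 < r & forall v v' : 'cV[R]_n,
    (forall i, `|w i 0 - v i 0| < r) ->
    (forall i, `|w i 0 - v' i 0| < r) -> `|g v - g v'| <= eta.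
Proof.
move=> eta0; have := g_loclip (x := (w, w)) (conj I I).
move=> [M [_ lipM]].
have MM : M < `|M| + 1 by rewrite (le_lt_trans (ler_norm M))// ltrDl.
have [[P1 P2] /= [nP1 nP2] PP] := lipM _ MM.
have [r1 /= r10 rP1] := (nbhs_ballP _ _).1 nP1.
have [r2 /= r20 rP2] := (nbhs_ballP _ _).1 nP2.
pose N := `|M| + 1; have N0 : 0 < N by rewrite ltr_wpDl.
pose r := Num.min (Num.min r1 r2) (eta / (2 * N)).
have r0 : 0 < r by rewrite !lt_min r10 r20/= divr_gt0 ?mulr_gt0.
exists r => // v v' wv wv'.
have ballr : forall u : 'cV[R]_n, (forall i, `|w i 0 - u i 0| < r) ->
    ball w r u.
  move=> u wu; split => // i j; rewrite (ord1 j) /ball/=; exact: wu.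
have b1 := ballr v wv; have b2 := ballr v' wv'.
have := PP (v, v'); rewrite /= => H.
have {}H : `|g v - g v'| <= N * `|v - v'|.
  apply: H => //; split.
    apply: rP1; apply: le_ball b1.
    by rewrite /r !ge_min lexx.
  apply: rP2; apply: le_ball b2.
  by rewrite /r !ge_min lexx orbT.
rewrite (le_trans H)// -ler_pdivlMl//.
move: b1 b2; rewrite mx_norm_ball /ball_/= => b1 b2.
have -> : v - v' = (w - v') - (w - v).
  by apply/matrixP => i j; rewrite !mxE; ring.
rewrite (le_trans (ler_normB _ _))//.
have : r <= eta / (2 * N) by rewrite /r ge_min lexx orbT.
have -> : N^-1 * eta = eta / (2 * N) + eta / (2 * N).
  by field; rewrite gt_eqF.
by move: b1 b2; lra.
Qed.

Lemma box_compact (r : R) :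
  compact [set v : 'rV[R]_n | forall i, `[- r, r]%classic (v 0 i)].
Proof.
apply: (@rV_compact R n (fun=> `[- r, r]%classic)) => i.
exact: segment_compact.
Qed.

Lemma near_coord (v : 'rV[R]_n) (r : R) : 0 < r ->
  nbhs v [set v' : 'rV[R]_n | forall i, `|v 0 i - v' 0 i| < r].
Proof.
move=> r0; apply/nbhs_ballP; exists r => //= v' [_ vv'] i.
by have := vv' 0 i; rewrite /ball/=.
Qed.

(** A ball lies in a compact box, and near each point of the box g varies by at
    most 1. *)
Lemma terminal_cost_bounded (w : 'cV[R]_n) (r : R) :
  exists M : R, forall v, enorm (v - w) <= r -> g v <= M.
Proof.
pose P (M : R) (v : 'rV[R]_n) := g v^T <= M.
have cov := (compact_near_coveringP _).1 (@box_compact (enorm w + r)).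
have [|N [_ HN]] := cov R (pinfty_nbhs R) P _.
  move=> v _; have [d d0 Hd] := local_oscillation v^T ltr01.
  exists ([set v' : 'rV[R]_n | forall i, `|v 0 i - v' 0 i| < d],
          [set M | g v^T + 1 < M]) => /=.
    split; first exact: near_coord.
    by exists (g v^T + 1); split; first exact: num_real.
  move=> [v' M] /= [vv' gM]; rewrite /P (le_trans _ (ltW gM))//.
  have : `|g v^T - g v'^T| <= 1.
    by apply: Hd => i; rewrite !mxE// subrr normr0.
  by rewrite ler_norml; lra.
exists (N + 1) => v vw.
have := HN (N + 1); rewrite ltrDl ltr01 => /(_ isT v^T).
rewrite /P trmxK; apply => i; rewrite mxE /= in_itv/= -ler_norml.
rewrite (le_trans (coord_le_enorm _ _))//.
have -> : v = w + (v - w) by rewrite [RHS]addrC subrK.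
by rewrite (le_trans (enormD _ _))// lerD2l.
Qed.

(** Heine's theorem on a compact box containing the ball. *)
Lemma terminal_cost_uniform (w : 'cV[R]_n) (r eta : R) : 0 < eta ->
  exists2 d : R, 0 < d & forall v v' : 'cV[R]_n,
    enorm (v - w) <= r -> enorm (v' - v) <= d -> `|g v' - g v| <= eta.
Proof.
move=> eta0.
pose P (d : R) (v : 'rV[R]_n) := forall v' : 'cV[R]_n,
  enorm (v' - v^T) <= d -> `|g v' - g v^T| <= eta.
have cov := (compact_near_coveringP _).1 (@box_compact (enorm w + r)).
have [|e /= e0 He] := cov R (at_right 0) P _.
  move=> v _; have [d d0 Hd] := local_oscillation v^T eta0.
  have d20 : 0 < d / 2 by rewrite divr_gt0.
  exists ([set v' : 'rV[R]_n | forall i, `|v 0 i - v' 0 i| < d / 2],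
          [set x | x < d / 2]) => /=.
    split; first exact: near_coord.
    exact: nbhs_right_lt.
  move=> [v' x] /= [vv' xd] u uv'; apply: Hd => i; last first.
    by rewrite !mxE (lt_trans (vv' i))// ltr_pdivrMr// ltr_pMr// ltr1n.
  rewrite mxE; have := coord_le_enorm (u - v'^T) i; rewrite !mxE => ui.
  have -> : v 0 i - u i 0 = (v 0 i - v' 0 i) - (u i 0 - v' 0 i) by ring.
  rewrite (le_lt_trans (ler_normB _ _))//.
  by move: ui uv' xd (vv' i); lra.
exists (e / 2); first by rewrite divr_gt0.
move=> v v' vw vv'.
have := He (e / 2); rewrite /ball_/= sub0r normrN gtr0_norm ?divr_gt0//.
rewrite ltr_pdivrMr// ltr_pMr// ltr1n => /(_ isT isT v^T).
rewrite /P trmxK; apply => //= i; rewrite mxE in_itv/= -ler_norml.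
rewrite (le_trans (coord_le_enorm _ _))//.
have -> : v = w + (v - w) by rewrite [RHS]addrC subrK.
by rewrite (le_trans (enormD _ _))// lerD2l.
Qed.

End terminal_cost.

(** * Concatenation of trajectories and stabilizability *)

Section concatenation.
Context (R : realType) (n m : nat) (A : 'M[R]_n) (B : 'M[R]_(n, m)).
Context (U : set 'cV[R]_m).
Implicit Types (a b c d t s T : R) (u v : R -> 'cV[R]_m) (y w : R -> 'cV[R]_n).
Local Notation mu := (@lebesgue_measure R).

Definition switch_at (V : Type) s (f g : R -> V) : R -> V :=
  fun t => if t <= s then f t else g t.

Lemma switch_atL (V : Type) s (f g : R -> V) t : t <= s ->
  switch_at s f g t = f t.
Proof. by rewrite /switch_at => ->. Qed.

Lemma switch_atR (V : Type) s (f g : R -> V) t : s < t -> switch_at s f g t = g t.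
Proof. by rewrite /switch_at ltNge => /negPf ->. Qed.

Lemma eq_feasible a b u1 u2 : (forall t, a < t -> t <= b -> u1 t = u2 t) ->
  feasible U a b u1 -> feasible U a b u2.
Proof.
move=> u12 [Iu aeU]; split; first exact: eq_sqint Iu.
apply: ae_imply aeU => t /= Ut tab; move: (tab);
  rewrite in_itv/= => /andP[at_ tb].
by rewrite -u12 ?(ltW tb)//; exact: Ut.
Qed.

Lemma feasible_sub a b c d u : a <= c -> d <= b ->
  feasible U a b u -> feasible U c d u.
Proof.
move=> ac db [Iu aeU]; split; first exact: sqint_sub Iu.
apply: ae_imply aeU => t /= Ut; rewrite in_itv/= => /andP[ct td].
by apply: Ut; rewrite in_itv/= (le_lt_trans ac ct) (lt_le_trans td db).
Qed.

Lemma feasible_shift a b k u : feasible U a b u ->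
  feasible U (a + k) (b + k) (fun t => u (t - k)).
Proof.
move=> [Iu aeU]; split; first exact: sqint_shift.
apply: ae_imply (ae_shift k aeU) => t /= Ut; rewrite in_itv/= => /andP[at_ tb].
by apply: Ut; rewrite in_itv/= ltrBrDr at_ ltrBlDr.
Qed.

(** The constraint may fail at the junction b, a null set. *)
Lemma feasible_cat a b c u : a <= b -> b <= c ->
  feasible U a b u -> feasible U b c u -> feasible U a c u.
Proof.
move=> ab bc [Iu aeU] [Iv aeV]; split; first exact: sqint_cat Iu Iv.
apply: ae_imply (ae_and (ae_and aeU aeV) (ae_neq b)) => t [[Ut Vt] tb].
rewrite in_itv/= => /andP[at_ tc].
have [tb'|bt|tbE] := ltgtP t b; last by rewrite tbE eqxx in tb.
  by apply: Ut; rewrite in_itv/= at_.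
by apply: Vt; rewrite in_itv/= bt.
Qed.

Lemma feasible_switch a b c u v : a <= b -> b <= c ->
  feasible U a b u -> feasible U b c v -> feasible U a c (switch_at b u v).
Proof.
move=> ab bc fu fv; apply: (feasible_cat ab bc).
  by apply: eq_feasible fu => t _ tb; rewrite switch_atL.
by apply: eq_feasible fv => t bt _; rewrite switch_atR.
Qed.

Lemma feasible_cst a b (u : 'cV[R]_m) : U u -> feasible U a b (fun=> u).
Proof.
move=> Uu; split; first exact: sqint_cst.
by apply: ae_imply (ae_neq 0) => t.
Qed.

Lemma eq_state_eq a b u1 y1 u2 y2 : (forall t, a < t -> t <= b -> u1 t = u2 t) ->
  (forall t, a <= t -> t <= b -> y1 t = y2 t) ->
  state_eq A B a b u1 y1 -> state_eq A B a b u2 y2.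
Proof.
move=> u12 y12; apply: eq_vprimitive => // t at_ tb.
by rewrite u12// y12// ltW.
Qed.

Lemma state_eq_sub a b c d u y : a <= c -> d <= b ->
  state_eq A B a b u y -> state_eq A B c d u y.
Proof. by move=> ac db; exact: vprimitive_sub. Qed.

Lemma state_eq_shift a b k u y : state_eq A B a b u y ->
  state_eq A B (a + k) (b + k) (fun t => u (t - k)) (fun t => y (t - k)).
Proof. by move=> st; exact: (vprimitive_shift k st). Qed.

Lemma state_eq_switch a b c u1 y1 u2 y2 : a <= b -> b <= c ->
  state_eq A B a b u1 y1 -> state_eq A B b c u2 y2 -> y1 b = y2 b ->
  state_eq A B a c (switch_at b u1 u2) (switch_at b y1 y2).
Proof.
move=> ab bc s1 s2 yb; apply: (vprimitive_cat ab bc).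
  by apply: eq_state_eq s1 => t _ tb; rewrite switch_atL.
apply: eq_state_eq s2 => t bt _; first by rewrite switch_atR.
by move: bt; rewrite le_eqVlt => /predU1P[<-|bt];
  [rewrite switch_atL|rewrite switch_atR].
Qed.

Definition global_pair u y : Prop :=
  forall T, 0 <= T -> feasible U 0 T u /\ state_eq A B 0 T u y.

Lemma global_pair_cst (u : 'cV[R]_m) (y : 'cV[R]_n) : U u ->
  A *m y + B *m u = 0 ->
  global_pair (fun=> u) (fun=> y).
Proof.
by move=> Uu E T T0; split; [exact: feasible_cst|exact: state_eq_cst].
Qed.

(** A pair given up to time T can be prolonged, as stabilizability requires
    reference trajectories that exist at all times. *)
Lemma global_pair_switch T u1 y1 u2 y2 : 0 <= T -> feasible U 0 T u1 ->
  state_eq A B 0 T u1 y1 -> global_pair u2 y2 -> y1 T = y2 0 ->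
  global_pair (switch_at T u1 (fun t => u2 (t - T))) (switch_at T y1 (fun t =>
    y2 (t - T))).
Proof.
move=> T0 f1 s1 gp yT.
have glob S : T <= S -> feasible U 0 S (switch_at T u1 (fun t => u2 (t - T))) /\
    state_eq A B 0 S (switch_at T u1 (fun t =>
      u2 (t - T))) (switch_at T y1 (fun t => y2 (t - T))).
  move=> TS; have [|f2 s2] := gp (S - T); first by rewrite subr_ge0.
  have := feasible_shift T f2; have := state_eq_shift T s2.
  rewrite add0r subrK => s3 f3; split; first exact: feasible_switch.
  by apply: state_eq_switch => //; rewrite subrr.
move=> S S0; have [TS|/ltW ST] := leP T S; first exact: glob.
have [f s] := glob T (lexx T).
by split; [exact: feasible_sub f|exact: state_eq_sub s].
Qed.

(** Each coordinate of e(b) - e(a) is at most the integral of the norm of f. *)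
Lemma vprimitive_growth k a b (e f : R -> 'cV[R]_k) : a <= b ->
  vprimitive a b e f -> integrable_oc a b (fun s => enorm (f s)) ->
  enorm (e b) <= enorm (e a) + k%:R * int_oc a b (fun s => enorm (f s)).
Proof.
move=> ab ef If.
have -> : e b = e a + (e b - e a) by rewrite [RHS]addrC subrK.
rewrite (le_trans (enormD _ _))// lerD2l (le_trans (enorm_le_sum _))//.
rewrite -[X in X%:R * _]card_ord mulr_natl -sumr_const; apply: ler_sum => i _.
rewrite !mxE (primitive_diff (ef i) (lexx a) ab (lexx b)).
rewrite (le_trans (int_oc_norm (ef i).1))//.
apply: le_int_oc => //; first exact/integrable_oc_norm/(ef i).1.
by move=> s _ _; exact: coord_le_enorm.
Qed.

(** The L1 and L2 bounds control the running cost, the bound at b the terminal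
    cost. *)
Definition tracks a b d u1 y1 u y : Prop :=
  [/\ int_oc a b (fun s => enorm (u s - u1 s)) <= d,
      int_oc a b (fun s => dot (u s - u1 s) (u s - u1 s)) <= d ^+ 2,
      int_oc a b (fun s => enorm (y s - y1 s)) <= d,
      int_oc a b (fun s => dot (y s - y1 s) (y s - y1 s)) <= d ^+ 2 &
      enorm (y b - y1 b) <= d].

(** Stabilizability bounds y - y1 in L1 and L2 only.  Since the derivative
    A (y - y1) + B (u - u1) is then bounded in L1, so is y - y1 at every time. *)
Theorem stabilizable_tracking : stabilizable A B U ->
  exists2 K : R, 1 <= K & forall u1 y1, global_pair u1 y1 ->
    forall x d, enorm (y1 0 - x) <= d ->
    exists u y, [/\ global_pair u y, y 0 = x &
      forall T, 0 <= T -> tracks 0 T (K * d) u1 y1 u y].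
Proof.
move=> [K0 stab]; pose K1 := `|K0|.
have [cA cA0 Ac] := enorm_mulmx A; have [cB cB0 Bc] := enorm_mulmx B.
pose K := 1 + K1 + n%:R * (cA * K1 + cB * K1).
have K10 : 0 <= K1 by exact: normr_ge0.
have nn0 : 0 <= n%:R * (cA * K1 +
  cB * K1) by rewrite mulr_ge0 ?addr_ge0 ?mulr_ge0.
exists K; first by rewrite /K -addrA lerDl addr_ge0.
move=> u1 y1 gp x d xd.
have d0 : 0 <= d by rewrite (le_trans _ xd) ?enorm_ge0.
have [||u [y [uL gy [[mu1 _] _] [[my1 _] _] le_norms]]] := stab u1 y1 _ _ x.
- by move=> T T0; apply/admissibleP; have [] := gp T (ltW T0).
- move=> T T0; apply/trajectoryP; first exact: ltW.
  by have [] := gp T (ltW T0).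
have gpu : global_pair u y.
  move=> T T0; have T1 : 0 < T + 1 by rewrite ltr_wpDl.
  have /admissibleP fu := uL _ T1.
  have /(trajectoryP _ _ _ _ _ (ltW T1))[su _] := gy _ T1.
  by split; [apply: feasible_sub fu|apply: state_eq_sub su]; rewrite // lerDl.
have y0 : y 0 = x.
  by have /(trajectoryP _ _ _ _ _ ler01)[] := gy _ ltr01.
exists u, y; split => // T T0.
have k0 : 0 <= K1 * d by rewrite mulr_ge0.
have leK : (norm_L1L2 (u \- u1)%R + norm_L1L2 (y \- y1)%R <= (K1 * d)%:E)%E.
  apply: (le_trans le_norms); rewrite lee_fin.
  rewrite (le_trans (ler_norm _))// normrM (ger0_norm (enorm_ge0 _)).
  by rewrite ler_wpM2l.
have n0 k (f : R -> 'cV[R]_k) : (0 <= norm_L1L2 f)%E.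
  by rewrite /norm_L1L2 adde_ge0// Lnorm_ge0.
have leu : (norm_L1L2 (u \- u1)%R <= (K1 * d)%:E)%E.
  by apply: le_trans leK; rewrite leeDl.
have ley : (norm_L1L2 (y \- y1)%R <= (K1 * d)%:E)%E.
  by apply: le_trans leK; rewrite leeDr.
have [Iu u_1 u_2] := L1L2_bounds T (lexx 0) k0 mu1 leu.
have [Iy y_1 y_2] := L1L2_bounds T (lexx 0) k0 my1 ley.
have K1K : K1 * d <= K * d.
  by rewrite ler_wpM2r// /K addrAC lerDr addr_ge0.
have K1K2 : (K1 * d) ^+ 2 <= (K * d) ^+ 2 by rewrite ler_sqr ?nnegrE ?(le_trans
  k0).
have [_ sy] := gpu T T0; have [_ sy1] := gp T T0.
have se := state_eqB sy sy1.
have If := sqint_integrable_enorm (sqintD (sqint_mulmx A Iy) (sqint_mulmx B Iu)).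
have Ieu := sqint_integrable_enorm Iu; have Iey := sqint_integrable_enorm Iy.
have growth := vprimitive_growth T0 se If.
have le_f : int_oc 0 T (fun s => enorm (A *m (y s - y1 s) + B *m (u s - u1 s))) <=
    cA * (K1 * d) + cB * (K1 * d).
  apply: (@le_trans _ _ (int_oc 0 T (fun s =>
      cA * enorm (y s - y1 s) + cB * enorm (u s - u1 s)))).
    apply: le_int_oc => //; first by apply: integrable_ocD; apply: integrable_ocZ.
    by move=> s _ _; rewrite (le_trans (enormD _ _))// lerD.
  by rewrite int_ocD ?int_ocZ//; [rewrite lerD// ler_wpM2l|exact:
    integrable_ocZ|exact: integrable_ocZ].
split.
- exact: le_trans u_1 K1K.
- exact: le_trans u_2 K1K2.
- exact: le_trans y_1 K1K.
- exact: le_trans y_2 K1K2.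
rewrite (le_trans growth)//= y0 -enormN opprB /K !mulrDl mul1r -!addrA lerD//.
rewrite -[leLHS]add0r lerD// -mulrA ler_wpM2l//.
by rewrite mulrDl -!mulrA.
Qed.

End concatenation.

(** * A priori bound and turnpike *)

(** The algebra of [optimal_a_priori_bound]: the bound on s brings a quarter of Q
    to the right-hand side, which the half of Q on the left absorbs. *)
Lemma energy_arith (F : realFieldType)
    (Q Jb Ju Jv gu gv G gl c pT pe pb s t E0 : F) :
  Ju + gu <= Jv + gv -> Jv <= Jb + c -> gv <= G -> gl <= gu ->
  2^-1 * Q - pT + Jb <= Ju -> pT = pe + pb -> 2 * pe <= s + t ->
  s <= 2^-1 * (E0 + Q) -> Q <= 4 * (c + G - gl + pb + E0 / 4 + t / 2).
Proof. by lra. Qed.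

(** The algebra of [optimal_middle_excess]: I1, I2, I3 are the costs of the optimal
    pair on the three time intervals, I2' and I3' those of its competitor. *)
Lemma excess_arith (F : realFieldType)
    (Q I1 I2 I3 I2' I3' gu gv pt Jb c1 c2 eta : F) :
  I1 + (I2 + I3) + gu <= I1 + (I2' + I3') + gv ->
  I2' <= Jb + c1 -> I3' <= I3 + c2 -> gv - gu <= eta ->
  2^-1 * Q - pt + Jb <= I2 -> Q <= 2 * (pt + c1 + c2 + eta).
Proof. by lra. Qed.

Section turnpike.
Context (R : realType) (n m : nat).
Context (A : 'M[R]_n) (B : 'M[R]_(n, m)) (C : 'M[R]_n) (z : 'cV[R]_n).
Context (U : set 'cV[R]_m) (g : 'cV[R]_n -> R) (x : 'cV[R]_n).
Context (ubar : 'cV[R]_m) (ybar : 'cV[R]_n).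
Implicit Types (a b c d t s T : R) (u v : R -> 'cV[R]_m) (y w : R -> 'cV[R]_n).
Local Notation J := (steady_cost C z).

Lemma integrable_oc_deviation k l a b (M : 'M[R]_(l, n)) (q : 'cV[R]_k) (r :
  'cV[R]_n)
    (f : R -> 'cV[R]_k) y : sqint a b f -> sqint a b y ->
  integrable_oc a b (fun s => dot (f s - q) (f s - q) +
    dot (M *m (y s - r)) (M *m (y s - r))).
Proof.
move=> If Iy; apply: integrable_ocD.
  by have [] := sqintB If (sqint_cst a b q).
by have [] := sqint_mulmx M (sqintB Iy (sqint_cst a b r)).
Qed.

Lemma integrable_oc_deviation1 k a b (q : 'cV[R]_k) (r : 'cV[R]_n)
    (f : R -> 'cV[R]_k) y : sqint a b f -> sqint a b y ->
  integrable_oc a b (fun s => dot (f s - q) (f s - q) + dot (y s - r) (y s - r)).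
Proof.
by move=> If Iy; apply: integrable_ocD; [have [] := sqintB If (sqint_cst a b q)|
  have [] := sqintB Iy (sqint_cst a b r)].
Qed.

Lemma le_int_oc_sub a b c d (f : R -> R) : a <= c -> c <= d -> d <= b ->
  (forall s, 0 <= f s) -> integrable_oc a b f -> int_oc c d f <= int_oc a b f.
Proof.
move=> ac cd db f0 If.
rewrite (int_oc_chasles ac (le_trans cd db))// (int_oc_chasles cd db);
  last exact: integrable_oc_sub If.
have h1 : 0 <= int_oc a c f by apply: int_oc_ge0.
have h2 : 0 <= int_oc d b f by apply: int_oc_ge0.
by lra.
Qed.

(** Otherwise f exceeds d on the whole interval. *)
Lemma exists_le_average a b (f : R -> R) (K d : R) : a <= b ->
  integrable_oc a b f ->
  int_oc a b f <= K -> K < d * (b - a) -> exists t, [/\ a < t, t <= b & f t <= d].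
Proof.
move=> ab If fK Kd; apply: contrapT => H.
have : d * (b - a) <= int_oc a b f.
  rewrite -(int_oc_cst _ ab); apply: le_int_oc => //;
    first exact: integrable_oc_cst.
  move=> s as_ sb; rewrite leNgt; apply/negP => fd; apply: H.
  by exists s; split => //; exact: ltW.
by move=> /le_trans /(_ fK); rewrite leNgt Kd.
Qed.

Lemma eq_tracks a b d u1 y1 u2 y2 u y : a <= b ->
  (forall s, a < s -> s <= b -> u1 s = u2 s) ->
  (forall s, a <= s -> s <= b -> y1 s = y2 s) ->
  tracks a b d u1 y1 u y -> tracks a b d u2 y2 u y.
Proof.
move=> ab u12 y12 [h1 h2 h3 h4 h5].
have y12' s : a < s -> s <= b -> y1 s = y2 s by move=> as_; apply: y12;
  exact: ltW.
split.
- by rewrite (eq_int_oc (g := fun s => enorm (u s - u1 s)))// => s ? ?;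
  rewrite u12.
- by rewrite (eq_int_oc (g := fun s => dot (u s - u1 s) (u s - u1 s)))// => s ? ?;
    rewrite u12.
- by rewrite (eq_int_oc (g := fun s => enorm (y s - y1 s)))// => s ? ?;
  rewrite y12'.
- by rewrite (eq_int_oc (g := fun s => dot (y s - y1 s) (y s - y1 s)))// => s ? ?;
    rewrite y12'.
- by rewrite -y12.
Qed.

Lemma tracks_shift a b k d u1 y1 u y :
  sqint a b u1 -> sqint a b y1 -> sqint a b u -> sqint a b y ->
  tracks a b d u1 y1 u y ->
  tracks (a + k) (b + k) d (fun s => u1 (s - k)) (fun s => y1 (s - k))
    (fun s => u (s - k)) (fun s => y (s - k)).
Proof.
move=> Iu1 Iy1 Iu Iy [h1 h2 h3 h4 h5].
have Iv := sqintB Iu Iu1; have Ie := sqintB Iy Iy1.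
split.
- by rewrite (int_oc_shift k (sqint_integrable_enorm Iv)).
- by rewrite (int_oc_shift k Iv.2).
- by rewrite (int_oc_shift k (sqint_integrable_enorm Ie)).
- by rewrite (int_oc_shift k Ie.2).
- by rewrite addrK.
Qed.

Context (n_gt0 : (0 < n)%N) (U_convex : convex_set U).
Context (g_loclip : [locally [lipschitz g v | v in setT]]).
Context (g_lbound : has_lbound (range g)).
Context (stabAB : stabilizable A B U) (detAC : detectable A C).
Context (A_unit : A \in unitmx) (Jmin : steady_minimizer A B C z U ubar ybar).

(** [detectable_estimate] applied to the deviation from the steady pair. *)
Let detectable_deviation :
  exists2 k : R, 0 <= k & forall a b u y, a <= b -> sqint a b u ->
    state_eq A B a b u y ->
    dot (y b - ybar) (y b - ybar) + int_oc a b (fun s =>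
      dot (y s - ybar) (y s - ybar)) <=
    k * (dot (y a - ybar) (y a - ybar) +
         int_oc a b (fun s => dot (u s - ubar) (u s - ubar) +
                           dot (C *m (y s - ybar)) (C *m (y s - ybar)))).
Proof.
have [k k0 det] := detectable_estimate B n_gt0 detAC.
exists k => // a b u y ab Iu st; have [[_ E] _] := Jmin.
exact: (det a b _ _ ab (sqintB Iu (sqint_cst a b ubar))
  (state_eqB st (state_eq_cst a b E))).
Qed.

Let tracks_steady_cost :
  exists2 k : R, 0 <= k & forall (K d : R) a b u1 y1 u y, 0 <= K -> 0 < d ->
    a <= b ->
    sqint a b u1 -> sqint a b y1 -> sqint a b u -> sqint a b y ->
    int_oc a b (fun s => dot (u1 s - ubar) (u1 s - ubar) +
                      dot (y1 s - ybar) (y1 s - ybar)) <= K ->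
    tracks a b d u1 y1 u y ->
    int_oc a b (fun s => J (u s) (y s)) <= int_oc a b (fun s => J (u1 s) (y1 s)) +
    k * (1 + K + d) * d.
Proof.
have [k k0 track] := tracking_cost C z ubar ybar; exists k => //.
move=> K d a b u1 y1 u y K0 d0 ab Iu1 Iy1 Iu Iy H1 [H2 H3 H4 H5 _].
by rewrite -lerBlDl; exact: track.
Qed.

Let tracks_cst_cost :
  exists2 k : R, 0 <= k & forall (d : R) a b u y, 0 < d -> a <= b ->
    sqint a b u -> sqint a b y -> tracks a b d (fun=> ubar) (fun=> ybar) u y ->
    int_oc a b (fun s => J (u s) (y s)) <=
      J ubar ybar * (b - a) + k * (1 + d) * d.
Proof.
have [k k0 track] := tracks_steady_cost; exists k => //.
move=> d a b u y d0 ab Iu Iy tr.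
have := track 0 d a b _ _ u y (lexx 0) d0 ab (sqint_cst _ _ _) (sqint_cst _ _
  _) Iu Iy _ tr.
by rewrite !int_oc_cst// !subrr !dot0r addr0 mul0r addr0 => /(_ (lexx 0)).
Qed.

(** Compare with a pair that follows the steady optimum from x.  By [dissipation]
    half of the integral Q of |v|^2 + |C e|^2 is at most a constant plus
    p . e(T), where v = u - ubar and e = y - ybar.  Detectability gives
    |e(T)|^2 <= kd (|e(0)|^2 + Q), so Young's inequality absorbs p . e(T) into
    Q / 4. *)
Theorem optimal_a_priori_bound : exists2 K : R, 0 <= K & forall T u y, 0 <= T ->
  optimal A B C z U g T x u y ->
  int_oc 0 T (fun s => dot (u s - ubar) (u s - ubar) +
                    dot (y s - ybar) (y s - ybar)) <= K /\
  dot (y T - ybar) (y T - ybar) <= K.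
Proof.
have [p dis] := dissipation U_convex A_unit Jmin.
have [kd kd0 det] := detectable_deviation.
have [kt kt0 track] := tracks_cst_cost.
have [Ks Ks1 stabT] := stabilizable_tracking stabAB.
have [[Ubar Ebar] _] := Jmin; rewrite /= in Ubar Ebar.
have [gl glow] := g_lbound.
pose d0 := enorm (ybar - x) + 1; pose d := Ks * d0.
have d00 : 0 < d0 by rewrite ltr_wpDl ?enorm_ge0.
have d_gt0 : 0 < d by rewrite mulr_gt0// (lt_le_trans _ Ks1).
have [G gG] := terminal_cost_bounded g_loclip ybar d.
pose E0 := dot (x - ybar) (x - ybar).
pose c3 := kt * (1 + d) * d + G - gl + dot p (ybar - x) + E0 / 4 +
  dot p p * (2 * (kd + 1)) / 2.
have E00 : 0 <= E0 by exact: dot_ge0.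
exists (`|4 * c3 + kd * (E0 + 4 * c3)|); first exact: normr_ge0.
move=> T u y T0 /(optimalP T0)[fu st y0 opt].
have xd0 : enorm (ybar - x) <= d0 by rewrite lerDl.
have [u' [y' [gp y'0 tr]]] := stabT _ _ (global_pair_cst Ubar Ebar) x d0 xd0.
have {gp} [fu' st'] := gp T T0; have {}tr := tr T T0.
have Iy' := vprimitive_sqint st'; have Iy := vprimitive_sqint st.
have opt1 := opt _ _ fu' st' y'0.
have cost1 := track d 0 T _ _ d_gt0 T0 fu'.1 Iy' tr.
have gG1 : g (y' T) <= G by apply: gG; have [] := tr.
have gl1 : gl <= g (y T) by apply: glow; exists (y T).
have dis1 := dis 0 T u y T0 fu st.
have det1 := det 0 T u y T0 fu.1 st.
rewrite y0 -/E0 in det1 dis1; rewrite subr0 in dis1 cost1.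
set Q := int_oc 0 T _ in dis1 det1.
set E := int_oc 0 T _ in det1.
have Q0 : 0 <= Q by apply: int_oc_ge0 => s _ _; rewrite addr_ge0 ?dot_ge0.
have Ege0 : 0 <= E by apply: int_oc_ge0 => s _ _; rewrite dot_ge0.
have pT : dot p (y T - x) = dot p (y T - ybar) + dot p (ybar - x).
  by rewrite -dotDr addrA subrK.
have al0 : 0 < (2 * (kd + 1))^-1 by rewrite invr_gt0 mulr_gt0// ltr_wpDl.
have := dot_young (y T - ybar) p al0; rewrite invrK (dotC _ p) => young.
have eT : (2 * (kd + 1))^-1 * dot (y T - ybar) (y T - ybar) <= 2^-1 * (E0 + Q).
  rewrite invfM -mulrA ler_wpM2l// ler_pdivrMl ?ltr_wpDl//.
  rewrite (le_trans _ (le_trans det1 _)) ?lerDl//.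
  by rewrite ler_wpM2r ?addr_ge0// lerDl.
have Qc : Q <= 4 * c3.
  exact: (energy_arith opt1 cost1 gG1 gl1 dis1 pT young eT).
have Qc' : kd * (E0 + Q) <= kd * (E0 + 4 * c3) by rewrite ler_wpM2l// lerD2l.
have eT0 := dot_ge0 (y T - ybar).
have KQ : E + dot (y T - ybar) (y T - ybar) <= kd * (E0 + 4 * c3).
  by rewrite addrC (le_trans det1).
have c30 : 0 <= 4 * c3 by exact: le_trans Qc.
split.
  2: by rewrite (le_trans _ (ler_norm _))// -[leLHS]add0r lerD// (le_trans _
    KQ)// lerDr.
rewrite (le_trans _ (ler_norm _))//.
have Iv := sqintB fu.1 (sqint_cst 0 T ubar).
have Ie := sqintB Iy (sqint_cst 0 T ybar).
rewrite int_ocD; [|exact: Iv.2|exact: Ie.2].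
have vQ : int_oc 0 T (fun s => dot (u s - ubar) (u s - ubar)) <= Q.
  apply: le_int_oc; [exact: Iv.2|exact: integrable_oc_deviation fu.1 Iy|].
  by move=> s _ _; rewrite lerDl dot_ge0.
rewrite -/E lerD// ?(le_trans vQ)// (le_trans _ KQ)// lerDl//.
Qed.


Lemma enorm_le_of_sqr k (v : 'cV[R]_k) d : 0 <= d -> dot v v <= d ^+ 2 ->
  enorm v <= d.
Proof. by move=> d0; rewrite -sqr_enorm ler_sqr ?nnegrE ?enorm_ge0. Qed.

(** If the optimal state is d-close to ybar at times t1 < t2, then on [t1, t2] the
    optimal pair can be replaced by one following the steady pair, and after t2
    by one following the optimal pair itself.  The cost of this replacement is of
    order d, up to the oscillation eta of the terminal cost.  By optimality and
    [dissipation] it bounds the integral of |v|^2 + |C e|^2 over [t1, t2]. *)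
Lemma optimal_middle_excess : exists c e : R, [/\ 0 <= c, 0 < e &
  forall eta : R, 0 < eta -> exists2 r : R, 0 < r &
  forall (d : R) T t1 t2 u y, 0 < d -> d <= 1 -> e * d <= r ->
    0 <= t1 -> t1 < t2 -> t2 <= T -> optimal A B C z U g T x u y ->
    dot (y t1 - ybar) (y t1 - ybar) <= d ^+ 2 ->
    dot (y t2 - ybar) (y t2 - ybar) <= d ^+ 2 ->
    int_oc t1 t2 (fun s => dot (u s - ubar) (u s - ubar) +
                        dot (C *m (y s - ybar)) (C *m (y s - ybar))) <=
    c * d + 2 * eta].
Proof.
have [p dis] := dissipation U_convex A_unit Jmin.
have [K K0 bound] := optimal_a_priori_bound.
have [kc kc0 track_cst] := tracks_cst_cost.
have [kt kt0 track] := tracks_steady_cost.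
have [Ks Ks1 stabT] := stabilizable_tracking stabAB.
have [[Ubar Ebar] _] := Jmin; rewrite /= in Ubar Ebar.
have Ks0 : 0 < Ks by exact: lt_le_trans Ks1.
pose e := Ks * (Ks + 1).
have e0 : 0 < e by rewrite mulr_gt0// addr_gt0.
pose c := 2 * (2 * enorm p + kc * (1 + Ks) * Ks + kt * (1 + K + e) * e).
have c0 : 0 <= c.
  by rewrite /c mulr_ge0// !addr_ge0// ?mulr_ge0// ?enorm_ge0// ?addr_ge0// ltW.
exists c, e; split=> // eta eta0.
have [r r0 gr] := terminal_cost_uniform g_loclip ybar (K + 1) eta0.
exists r => // d T t1 t2 u y d0 d1 edr t10 t12 t2T opt yt1 yt2.
have T0 : 0 <= T by rewrite (le_trans t10)// (le_trans (ltW t12)).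
have t20 : 0 <= t2 by rewrite (le_trans t10)// ltW.
have [NK yTK] := bound T u y T0 opt.
have [fu st y0 optu] := optimalP T0 opt.
have dW := ltW d0.
have {yt1} yt1 := enorm_le_of_sqr dW yt1;
  have {yt2} yt2 := enorm_le_of_sqr dW yt2.
have gpc := global_pair_cst Ubar Ebar.
(* From time t1 on, follow the steady pair. *)
have yt1' : enorm (ybar - y t1) <= d by rewrite -enormN opprB.
have [u1 [y1 [gp1 y10 tr1]]] := stabT _ _ gpc (y t1) d yt1'.
have t120 : 0 <= t2 - t1 by rewrite subr_ge0 ltW.
have [fu1 st1] := gp1 _ t120; have {}tr1 := tr1 _ t120.
have := feasible_shift t1 fu1; have := state_eq_shift t1 st1.
rewrite add0r subrK => sst1 sfu1.
have str1 := tracks_shift t1 (sqint_cst 0 (t2 - t1) ubar) (sqint_cst 0 (t2 -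
  t1) ybar)
  fu1.1 (vprimitive_sqint st1) tr1; rewrite add0r subrK in str1.
(* After time t2, follow the optimal pair.  As a reference for all times, it is
   continued after T by a pair steering y T to the steady state. *)
have [u2 [y2 [gp2 y20 _]]] := stabT _ _ gpc (y T) (enorm (ybar - y T)) (lexx _).
have fut : feasible U t2 T u by exact: feasible_sub fu.
have stt : state_eq A B t2 T u y by exact: state_eq_sub st.
have := feasible_shift (- t2) fut; have := state_eq_shift (- t2) stt.
rewrite subrr => sst sfu.
have Tt2 : 0 <= T - t2 by rewrite subr_ge0.
have yTE : y (T - t2 - - t2) = y2 0 by rewrite opprK subrK y20.
have gp3 := global_pair_switch Tt2 sfu sst gp2 yTE.
set u3 := switch_at _ _ _ in gp3; set y3 := switch_at _ _ _ in gp3.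
have y30 : y3 0 = y t2 by rewrite /y3 switch_atL// opprK add0r.
pose x2 := y1 (t2 - t1).
have x2d : enorm (y3 0 - x2) <= (Ks + 1) * d.
  have -> : y3 0 - x2 = (y t2 - ybar) - (x2 - ybar).
    by rewrite y30 opprB addrA subrK.
  rewrite (le_trans (enormB _ _))// mulrDl mul1r addrC lerD//.
  by have [] := tr1.
have [u4 [y4 [gp4 y40 tr4]]] := stabT _ _ gp3 x2 ((Ks + 1) * d) x2d.
have [fu4 st4] := gp4 _ Tt2; have {}tr4 := tr4 _ Tt2.
have [fu3 st3] := gp3 _ Tt2.
have := feasible_shift t2 fu4; have := state_eq_shift t2 st4.
rewrite add0r subrK => sst4 sfu4.
have str4 := tracks_shift t2 fu3.1 (vprimitive_sqint st3) fu4.1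
  (vprimitive_sqint st4) tr4; rewrite add0r subrK mulrA -/e in str4.
have {}str4 : tracks t2 T (e * d) u y (fun s => u4 (s - t2)) (fun s =>
  y4 (s - t2)).
  apply: eq_tracks str4 => // s st2 sT.
    by rewrite /u3 switch_atL ?lerB// opprK subrK.
  by rewrite /y3 switch_atL ?lerB// opprK subrK.
(* The competitor glues u, u1 and u4 at t1 and t2.  Its state at T is the end of
   the last piece, also when t2 = T, because the pieces agree at t2. *)
have ut1 : feasible U 0 t1 u by apply: feasible_sub fu => //;
  exact: le_trans (ltW t12) t2T.
have st_t1 : state_eq A B 0 t1 u y.
  by apply: state_eq_sub st => //; exact: le_trans (ltW t12) t2T.
pose w1 := switch_at t2 (fun s => y1 (s - t1)) (fun s => y4 (s - t2)).
pose v1 := switch_at t2 (fun s => u1 (s - t1)) (fun s => u4 (s - t2)).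
have fv1 : feasible U t1 T v1 by apply: feasible_switch => //; exact: ltW.
have sw1 : state_eq A B t1 T v1 w1.
  by apply: state_eq_switch => //; [exact: ltW|rewrite subrr y40].
have t1T : t1 <= T by exact: le_trans (ltW t12) t2T.
pose w := switch_at t1 y w1; pose v := switch_at t1 u v1.
have fv : feasible U 0 T v by exact: feasible_switch.
have sw : state_eq A B 0 T v w.
  apply: state_eq_switch => //.
  by rewrite /w1 switch_atL ?ltW// subrr y10.
have w0 : w 0 = x by rewrite /w switch_atL.
have wT : w T = y4 (T - t2).
  rewrite /w switch_atR ?(lt_le_trans t12)// /w1.
  have [<-|t2T'] := eqVneq t2 T; first by rewrite switch_atL// subrr y40.
  by rewrite switch_atR// lt_neqAle t2T'.
have optw := optu v w fv sw w0.
have Iu := integrable_oc_steady_cost C z fu.1 (vprimitive_sqint st).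
have Iv := integrable_oc_steady_cost C z fv.1 (vprimitive_sqint sw).
have Iu2 : integrable_oc t1 T (fun s =>
  J (u s) (y s)) by exact: integrable_oc_sub Iu.
have Iv2 : integrable_oc t1 T (fun s =>
  J (v s) (w s)) by exact: integrable_oc_sub Iv.
rewrite (int_oc_chasles t10 t1T Iu) (int_oc_chasles t10 t1T Iv) in optw.
rewrite (int_oc_chasles (ltW t12) t2T Iu2) (int_oc_chasles (ltW t12) t2T Iv2)
  in optw.
have E1 : int_oc 0 t1 (fun s => J (v s) (w s)) = int_oc 0 t1 (fun s =>
  J (u s) (y s)).
  by apply: eq_int_oc => s _ st1'; rewrite /v /w !switch_atL.
have E2 : int_oc t1 t2 (fun s => J (v s) (w s)) =
    int_oc t1 t2 (fun s => J (u1 (s - t1)) (y1 (s - t1))).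
  by apply: eq_int_oc => s t1s st2;
    rewrite /v /w !switch_atR// /v1 /w1 !switch_atL.
have E3 : int_oc t2 T (fun s => J (v s) (w s)) =
    int_oc t2 T (fun s => J (u4 (s - t2)) (y4 (s - t2))).
  by apply: eq_int_oc => s t2s sT;
    rewrite /v /w !switch_atR ?(lt_trans t12)// /v1 /w1 !switch_atR.
rewrite E1 E2 E3 wT in optw.
have d1_gt0 : 0 < Ks * d by rewrite mulr_gt0.
have d2_gt0 : 0 < e * d by rewrite mulr_gt0.
have C1 := track_cst _ _ _ _ _ d1_gt0 (ltW t12) sfu1.1 (vprimitive_sqint sst1)
  str1.
have NK2 : int_oc t2 T (fun s => dot (u s - ubar) (u s - ubar) +
                    dot (y s - ybar) (y s - ybar)) <= K.
  apply: le_trans NK; apply: le_int_oc_sub => //.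
    by move=> s; rewrite addr_ge0 ?dot_ge0.
  exact: integrable_oc_deviation1 fu.1 (vprimitive_sqint st).
have C2 := track K _ _ _ _ _ _ _ K0 d2_gt0 t2T fut.1 (vprimitive_sqint stt) sfu4.1
  (vprimitive_sqint sst4) NK2 str4.
have G : g (y4 (T - t2)) - g (y T) <= eta.
  rewrite (le_trans (ler_norm _))//; apply: gr.
    apply: enorm_le_of_sqr; first by rewrite addr_ge0.
    rewrite (le_trans yTK)//; have := sqr_ge0 K; rewrite sqrrD; move: K0.
    by rewrite expr1n mulr1 => K0' K2;
      rewrite (le_trans _ (_ : K *+ 2 <=
        _))// ?mulr2n ?lerDl// addrAC lerDr addr_ge0.
  by rewrite (le_trans _ edr)//; have [] := str4.
have fu12 : feasible U t1 t2 u by exact: feasible_sub fu.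
have st12 : state_eq A B t1 t2 u y by exact: state_eq_sub st.
have D := dis _ _ u y (ltW t12) fu12 st12.
apply: (le_trans (excess_arith optw C1 C2 G D)).
have P : dot p (y t2 - y t1) <= 2 * enorm p * d.
  rewrite (le_trans (ler_norm _))// (le_trans (dot_cauchy _ _))//.
  rewrite mulrAC mulrC ler_wpM2r ?enorm_ge0//.
  have -> : y t2 - y t1 = (y t2 - ybar) - (y t1 - ybar) by rewrite opprB addrA
    subrK.
  by rewrite (le_trans (enormB _ _))// mulr_natl mulr2n lerD.
have c1d : kc * (1 + Ks * d) * (Ks * d) <= kc * (1 + Ks) * Ks * d.
  rewrite -[leRHS]mulrA ler_wpM2r ?(ltW d1_gt0)// ler_wpM2l// lerD2l.
  by rewrite ler_piMr// ltW.
have c2d : kt * (1 + K + e * d) * (e * d) <= kt * (1 + K + e) * e * d.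
  rewrite -[leRHS]mulrA ler_wpM2r ?(ltW d2_gt0)// ler_wpM2l// lerD2l.
  by rewrite ler_piMr// ltW.
have -> : c * d = 2 * (2 * enorm p * d + kc * (1 + Ks) * Ks * d +
    kt * (1 + K + e) * e * d) by rewrite /c; ring.
by rewrite mulrDr lerD2r ler_pM2l// !lerD.
Qed.

(** The a priori bound gives a time t1 in ]0, tau] and a time t2 in ]T - tau, T]
    at which y is d-close to ybar, where d^2 tau > K.  Then
    [optimal_middle_excess] and detectability started at t1 make y close to ybar
    at all times of [t1, t2]. *)
Theorem turnpike_property (eps : R) : 0 < eps -> exists2 tau : R, 0 < tau &
  forall T u y, 2 * tau + 1 <= T -> optimal A B C z U g T x u y ->
  forall t, tau <= t -> t <= T - tau -> dot (y t - ybar) (y t - ybar) < eps ^+ 2.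
Proof.
move=> eps0.
have [K K0 bound] := optimal_a_priori_bound.
have [kd kd0 det] := detectable_deviation.
have [c [e [c0 e0 excess]]] := optimal_middle_excess.
have k1 : 0 < kd + 1 by rewrite ltr_wpDl.
pose h := eps ^+ 2 / (kd + 1).
have h0 : 0 < h by rewrite divr_gt0 ?exprn_gt0.
have eta0 : 0 < h / 8 by rewrite divr_gt0.
have [r r0 ex] := excess _ eta0.
have c10 : 0 < c + 1 by rewrite ltr_wpDl.
(* d bounds the two distances to ybar: edr makes the terminal cost of the
   competitor eta-close to the optimal one, cdh keeps the final sum below h / 2. *)
pose d := Num.min 1 (Num.min (r / e) (h / (4 * (c + 1)))).
have d0 : 0 < d by rewrite !lt_min ltr01 !divr_gt0 ?mulr_gt0.
have d1 : d <= 1 by rewrite ge_min lexx.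
have edr : e * d <= r.
  by rewrite mulrC -ler_pdivlMr// !ge_min lexx orbT.
have cdh : (c + 1) * d <= h / 4.
  rewrite mulrC -ler_pdivlMr//.
  have -> : h / 4 / (c + 1) = h / (4 * (c + 1)) by field; rewrite gt_eqF.
  by rewrite !ge_min lexx !orbT.
pose tau := K / d ^+ 2 + 1.
have tau0 : 0 < tau by rewrite ltr_wpDl// divr_ge0// ltW// exprn_gt0.
have Ktau : K < d ^+ 2 * tau.
  by rewrite mulrDr mulr1 mulrCA mulfV ?gt_eqF ?exprn_gt0// mulr1 ltrDl exprn_gt0.
exists tau => // T u y Ttau opt t taut tT.
have T0 : 0 <= T by rewrite (le_trans _ Ttau)// addr_ge0 ?mulr_ge0// ltW.
have [NK _] := bound T u y T0 opt.
have [fu st _ _] := optimalP T0 opt.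
have Iy := vprimitive_sqint st.
have [_ Iee] := sqintB Iy (sqint_cst 0 T ybar).
have tauT : tau <= T - tau - 1 by move: Ttau; lra.
have small a b : 0 <= a -> b <= T -> b - a = tau ->
    exists s, [/\ a < s, s <= b & dot (y s - ybar) (y s - ybar) <= d ^+ 2].
  move=> a0 bT bat.
  have ab : a <= b by rewrite -subr_ge0 bat ltW.
  apply: (@exists_le_average _ _ (fun s => dot (y s - ybar) (y s - ybar)) K) =>
    //.
  - exact: integrable_oc_sub Iee.
  - apply: le_trans NK.
    have Iab : integrable_oc 0 T (fun s => dot (u s - ubar) (u s - ubar) +
        dot (y s - ybar) (y s - ybar)) by exact: integrable_oc_deviation1 fu.1 Iy.
    apply: (@le_trans _ _ (int_oc 0 T (fun s => dot (y s - ybar) (y s - ybar)))).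
      by apply: le_int_oc_sub => // s; exact: dot_ge0.
    by apply: le_int_oc => // s _ _; rewrite lerDr dot_ge0.
  - by rewrite bat.
have tauT' : tau <= T by move: tau0 tauT; lra.
have [||t1 [t10 t1tau yt1]] := small 0 tau _ _ (subr0 tau); [by []|by []|].
have [|||t2 [t2l t2T yt2]] := small (T - tau) T;
  [by rewrite subr_ge0|by []|by rewrite opprB addrC subrK|].
have t12 : t1 < t2.
  by rewrite (le_lt_trans t1tau)// (lt_trans _ t2l)// (le_lt_trans tauT)//
    ltrBlDr ltrDl.
have Q := ex d T t1 t2 u y d0 d1 edr (ltW t10) t12 t2T opt yt1 yt2.
have t1t : t1 <= t by exact: le_trans taut.
have tt2 : t <= t2 by rewrite (le_trans tT)// ltW.
have fu1 : sqint t1 t u by apply: sqint_sub fu.1;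
  [exact: ltW|exact: le_trans t2T].
have st1 : state_eq A B t1 t u y.
  by apply: state_eq_sub st; [exact: ltW|exact: le_trans t2T].
have D := det t1 t u y t1t fu1 st1.
have Q' : int_oc t1 t (fun s => dot (u s - ubar) (u s - ubar) +
   dot (C *m (y s - ybar)) (C *m (y s - ybar))) <= c * d + 2 * (h / 8).
  apply: le_trans Q; apply: le_int_oc_sub => //.
    by move=> s; rewrite addr_ge0 ?dot_ge0.
  by apply: integrable_oc_deviation;
    [apply: sqint_sub fu.1|apply: sqint_sub Iy] => //; exact: ltW.
have E0 : 0 <= int_oc t1 t (fun s => dot (y s - ybar) (y s - ybar)).
  by apply: int_oc_ge0 => s _ _; exact: dot_ge0.
apply: (@le_lt_trans _ _ (kd * (h / 2))); last first.
  rewrite /h mulrA ltr_pdivrMr// mulrA ltr_pdivrMr//.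
  have e2 : 0 < eps ^+ 2 by rewrite exprn_gt0.
  by rewrite mulrC -mulrA ltr_pM2l//; move: kd0; lra.
apply: (@le_trans _ _ (kd * (d ^+ 2 + (c * d + 2 * (h / 8))))).
  rewrite (le_trans _ (le_trans D _)) ?lerDl//.
  by rewrite ler_wpM2l// lerD.
rewrite ler_wpM2l//.
have dd : d ^+ 2 <= d by rewrite expr2 ler_piMr// ltW.
by move: cdh dd; rewrite mulrDl mul1r; move: (d ^+ 2) (c * d) => d2 cd; lra.
Qed.

End turnpike.

Theorem theorem1p2 (R : realType) (n m : nat)
  (hn : (0 < n)%N) (hm : (0 < m)%N)
  (A : 'M[R]_n) (B : 'M[R]_(n, m)) (C : 'M[R]_n) (z : 'cV[R]_n)
  (U : set 'cV[R]_m) (hU0 : U !=set0) (hUclosed : closed U)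
  (hUconvex : convex_set U)
  (g : 'cV[R]_n -> R) (hglip : [locally [lipschitz g v | v in setT]])
  (hgbound : has_lbound (range g))
  (x : 'cV[R]_n)
  (hstab : stabilizable A B U) (hdet : detectable A C) (hA : A \in unitmx)
  (ubar : 'cV[R]_m) (ybar : 'cV[R]_n)
  (hbar : steady_minimizer A B C z U ubar ybar) :
  (forall eps : R, 0 < eps -> eps < 1 ->
     exists2 tau : R, 0 < tau &
       forall (T : R) (uT : R -> 'cV[R]_m) (yT : R -> 'cV[R]_n),
         2 * tau + 1 <= T -> optimal A B C z U g T x uT yT ->
         forall t : R, t \in `[tau, T - tau] -> enorm (yT t - ybar) < eps) /\
  (exists K : R,
     forall (T : R) (uT : R -> 'cV[R]_m) (yT : R -> 'cV[R]_n),
       0 < T -> optimal A B C z U g T x uT yT ->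
       (\int[lebesgue_measure]_(s in `]0%R, T[)
          (enorm (uT s - ubar) ^+ 2 + enorm (yT s - ybar) ^+ 2)%:E <= K%:E)%E).
Proof.
split=> [eps eps0 _|].
  have [tau tau0 turn] := turnpike_property x hn hUconvex hglip hgbound hstab hdet
    hA hbar eps0.
  exists tau => // T uT yT TT opt t; rewrite in_itv/= => /andP[t1 t2].
  by rewrite -(ltr_sqr (enorm_ge0 _) (ltW eps0)) sqr_enorm;
    exact: turn TT opt _ t1 t2.
have [K _ bound] := optimal_a_priori_bound x hn hUconvex hglip hgbound hstab hdet
  hA hbar.
exists K => T uT yT T0 opt; have [NK _] := bound T uT yT (ltW T0) opt.
have [fu st _ _] := optimalP (ltW T0) opt.
have I := integrable_oc_deviation1 ubar ybar fu.1 (vprimitive_sqint st).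
under eq_integral do rewrite !sqr_enorm.
by rewrite int_oc_EFin// lee_fin.
Qed.
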